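(* Let $\mathcal V_{X^2}\subset\mathbb P(\mathrm{Sym}^2\mathbb C^n)$ be the Zariski closure of the image of the rational map $$(-)^2:\ \mathbb P(\wedge^2\mathbb C^n)\dashrightarrow \mathbb P(\mathrm{Sym}^2\mathbb C^n),\qquad X\mapsto X^2 .$$ Then: (1) The variety $\mathcal V_{X^2}$ has the expected dimension $\binom n2-1$. (2) $\mathcal V_{X^2}$ is the Zariski closure of the set of symmetric diagonalizable $n\times n$ matrices whose nonzero eigenvalues have multiplicity $2$. (3) The fiber of $(-)^2$ containing a generic rank $2r$ skew-symmetric $n\times n$ matrix $X$ has size $2^{r-1}$.
   Context: $\mathbb P(\wedge^2\mathbb C^n)$ is the projective space of nonzero complex skew-symmetric $n\times n$ matrices up to scaling, and $\mathbb P(\mathrm{Sym}^2\mathbb C^n)$ is the projective space of nonzero complex symmetric $n\times n$ matrices up to scaling. The map $(-)^2$ is defined at those $X$ with $X^2\neq 0$. The fiber of $(-)^2$ containing $X$ is the set of all points of $\mathbb P(\wedge^2\mathbb C^n)$ with the same image as $X$ in $\mathbb P(\mathrm{Sym}^2\mathbb C^n)$. ''Generic'' means outside some proper Zariski-closed subset of the locus of skew-symmetric matrices of rank at most $2r$.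
   Formalization: In (3), with r≥1 and 2r≤n, the fiber containing a generic rank 2r matrix is counted only among points of rank at most 2r; the full fiber is claimed to have size 2^{r-1} only for n<2r+4, because for n≥2r+4 the full generic fiber is infinite and the claim as worded is false. *)

(* Defs.v *)
From mathcomp Require Export all_boot all_order all_algebra.
From mathcomp Require Export classical_sets cardinality reals.
From mathcomp Require Export complex mpoly.

Set Implicit Arguments.
Unset Strict Implicit.
Unset Printing Implicit Defensive.

Import Order.TTheory GRing.Theory.

Local Open Scope classical_set_scope.
Local Open Scope ring_scope.

Section ProjectiveMatrices.
Variables (K : fieldType) (n : nat).

Implicit Types (W A : set 'M[K]_n) (Z V : set {vspace 'M[K]_n}).

(* A projective point is the line <[X]> of a nonzero X. For a linear subspace
   W, [proj W] is the projective space P(W); for any set A of matrices,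
   [proj A] is the set of points having a nonzero representative in A. *)
Definition proj A : set {vspace 'M[K]_n} :=
  [set <[X]>%VS | X in [set X | A X /\ X != 0]].

Definition skew : set 'M[K]_n := [set X | X^T = - X].

Definition symm : set 'M[K]_n := [set X | X^T = X].

Definition entries (X : 'M[K]_n) : 'I_(n * n) -> K := fun k => mxvec X 0 k.

(* Polynomials on a linear subspace W are written in the n * n coordinates of
   the ambient matrix space; every homogeneous form on W is the restriction of
   one on the ambient space. *)
Definition zero_locus W (F : set {mpoly K[n * n]}) : set {vspace 'M[K]_n} :=
  proj [set X | W X /\ forall p, F p -> p.@[entries X] = 0].

Definition zariski_closed W Z : Prop :=
  exists2 F : set {mpoly K[n * n]},
    (forall p, F p -> exists d, p \is d.-homog) & Z = zero_locus W F.

Definition zariski_closure W Z : set {vspace 'M[K]_n} :=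
  \bigcap_(T in [set T | zariski_closed W T /\ Z `<=` T]) T.

Definition irreducible_closed W Z : Prop :=
  [/\ zariski_closed W Z, Z !=set0 &
      forall T1 T2, zariski_closed W T1 -> zariski_closed W T2 ->
        Z `<=` T1 `|` T2 -> Z `<=` T1 \/ Z `<=` T2].

(* c 0, ..., c (k - 1) is a strictly increasing chain of k irreducible closed
   subsets of V. *)
Definition irreducible_chain W V k (c : nat -> set {vspace 'M[K]_n}) : Prop :=
  (forall i, (i < k)%N -> irreducible_closed W (c i) /\ c i `<=` V) /\
  (forall i, (i.+1 < k)%N -> c i `<` c i.+1).

(* Krull dimension of V: a chain Z_0 < ... < Z_d has d + 1 members. In
   particular the empty set has dimension -1. *)
Definition has_dimension W V (d : int) : Prop :=
  (exists k c, irreducible_chain W V k c /\ k%:Z = d + 1) /\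
  (forall k c, irreducible_chain W V k c -> k%:Z <= d + 1).

Definition sq_variety : set {vspace 'M[K]_n} :=
  zariski_closure symm (proj [set X ^+ 2 | X in skew]).

Definition double_eigenvalues : set 'M[K]_n :=
  [set S | [/\ symm S, diagonalizable S &
    forall a : K, a != 0 -> eigenvalue S a -> mup a (char_poly S) = 2]].

Definition skew_rank_le m : set 'M[K]_n :=
  [set X | skew X /\ (\rank X <= m)%N].

(* The fiber of (-)^2 through <[X]>, for X skew with X ^+ 2 != 0. It can meet
   ranks above \rank X: if N is skew with N ^+ 2 = 0, X * N = 0 and N * X = 0,
   then every <[X + t *: N]> lies in it. For generic X of rank 2 * r such an
   N != 0 exists exactly when n >= 2 * r + 4. *)
Definition sq_fiber (X : 'M[K]_n) : set {vspace 'M[K]_n} :=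
  proj [set Y | [/\ skew Y, Y ^+ 2 != 0 & <[Y ^+ 2]>%VS = <[X ^+ 2]>%VS]].

End ProjectiveMatrices.

Arguments skew {K n}.
Arguments symm {K n}.
Arguments double_eigenvalues {K n}.
Arguments skew_rank_le {K n}.
Arguments sq_variety : clear implicits.

(* Main.v *)
Require Import Defs.
From mathcomp Require Import boolp zify ring.

(** Why the theorem holds.

    Generic squares. For a skew-symmetric X, the eigenvalues of X come in pairs m, - m,
    and S = X ^+ 2 is symmetric with eigenvalues m ^ 2. If X has rank at most 2 r and S
    has r distinct nonzero eigenvalues, then by counting dimensions each of them has an
    eigenplane, these planes span the image of X, and S is diagonalizable
    ([generic_split]). Having r distinct nonzero eigenvalues follows from one polynomial
    inequality, the nonvanishing of the Hankel determinant of the traces of the powers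
    of S ([hankel_eigenvalues]), which holds for a sum of scaled plane rotations
    ([hankel_block_example]). So it holds generically.

    Fibers. The spectral projections of S are polynomials in S, hence symmetric, and
    they commute with every square root Y of S. Since so(2) is a line, a skew-symmetric
    Y is + X or - X on each of the r eigenplanes ([root_signed_blocks]). On the kernel
    of S it is skew-symmetric with square 0, so it vanishes there when the rank of Y is
    at most 2 r, or when the kernel has dimension less than 4 ([root_kernel0]). This
    leaves 2 ^ r matrices, and 2 ^ (r - 1) points because Y and - Y give the same one.

    Double eigenvalues. With r = n / 2 the generic square has only double nonzero
    eigenvalues, and a polynomial vanishing on the generic squares vanishes on all of
    them. Conversely a symmetric diagonalizable S with double nonzero eigenvalues is a
    combination of symmetric projections of rank 2, each of which is the square of a
    skew-symmetric matrix ([rank2_projection_sqrt], [double_square]).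

    Dimension. Krull dimension is compared with the growth of the number of independent
    polynomial functions of degree O(D). A chain of k irreducible closed sets yields
    forms f_1, ..., f_k, each vanishing on one set and not on the next one, whose
    D ^ k monomials with exponents less than D are independent on the last set
    ([growth_chain]). But polynomials on the squares of an m-dimensional space of
    matrices pull back to polynomials in m variables, which leaves only O(D ^ m)
    independent ones ([squares_dependent]); hence k <= m ([chain_length]). For the
    existence of a chain, let X0 be skew-symmetric with simple spectrum. The
    differential H |-> X0 H + H X0 of the squaring map is injective on skew-symmetric
    matrices ([anticommute0]), so coordinates of X ^+ 2 near X0 are algebraically
    independent on the squares of any m-dimensional space through X0
    ([squares_free]), and by the same count the closures of the squares of the members
    of a flag of such spaces increase strictly ([sq_dimension]). *)

Set Implicit Arguments.
Unset Strict Implicit.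
Unset Printing Implicit Defensive.

Import Order.TTheory GRing.Theory Num.Theory.

Local Open Scope classical_set_scope.
Local Open Scope ring_scope.

(** * Polynomial functions over an infinite field *)

Section PolynomialFunctions.
Variable K : numClosedFieldType.

Lemma poly_eq0_fun (u : {poly K}) : (forall t, t != 0 -> u.[t] = 0) -> u = 0.
Proof.
move=> u0; apply/eqP; apply: contraT => nz_u.
have: (size [seq i.+1%:R : K | i <- iota 0 (size u)] < size u)%N.
  apply: max_poly_roots => //.
    by apply/allP=> _ /mapP[i _ ->]; apply/rootP/u0; rewrite pnatr_eq0.
  by rewrite map_inj_uniq ?iota_uniq // => i j /eqP; rewrite eqr_nat => /eqP[].
by rewrite size_map size_iota ltnn.
Qed.

Lemma poly_coef0_fun k (a : nat -> K) :
    (forall t, t != 0 -> \sum_(d < k) t ^+ d * a d = 0) ->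
  forall d, (d < k)%N -> a d = 0.
Proof.
move=> a0 d lt_dk; have : \poly_(d < k) a d = 0 :> {poly K}.
  apply: poly_eq0_fun => t /a0 <-; rewrite horner_poly.
  by apply: eq_bigr => i _; rewrite mulrC.
by move=> /(congr1 (fun p : {poly K} => p`_d)); rewrite coef_poly lt_dk coef0.
Qed.

(** Uniqueness of the digits in base D. *)
Lemma digits_inj (D n : nat) (m1 m2 : nat -> nat) :
    (forall j, (j < n)%N -> (m1 j < D)%N /\ (m2 j < D)%N) ->
    (\sum_(j < n) m1 j * D ^ j = \sum_(j < n) m2 j * D ^ j)%N ->
  forall j, (j < n)%N -> m1 j = m2 j.
Proof.
elim: n m1 m2 => [//|n IHn] m1 m2 ltD.
have recE (m : nat -> nat) :
    (\sum_(j < n.+1) m j * D ^ j = (\sum_(j < n) m j.+1 * D ^ j) * D + m 0)%N.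
  rewrite big_ord_recl expn0 muln1 addnC big_distrl /=; congr (_ + _)%N.
  by apply: eq_bigr => j _; rewrite expnS mulnA mulnAC.
have [lt1 lt2] := ltD 0%N isT; have D_gt0 : (0 < D)%N by case: (D) lt1.
rewrite !recE => E.
have E0 : m1 0 = m2 0.
  by move: (congr1 (modn^~ D) E); rewrite !modnMDl !modn_small.
have Es : (\sum_(j < n) m1 j.+1 * D ^ j = \sum_(j < n) m2 j.+1 * D ^ j)%N.
  by move: (congr1 (divn^~ D) E); rewrite !divnMDl // !divn_small // !addn0.
case=> [//|j] lt_jn; apply: (IHn (fun j => m1 j.+1) (fun j => m2 j.+1)) => //.
by move=> i lt_in; apply: ltD.
Qed.

(** Substituting z ^ (D ^ j) for the variable t j turns distinct monomials with exponents
    less than D into distinct powers of z. *)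
Lemma monomials_free (n D : nat) (c : {ffun 'I_n -> 'I_D} -> K) :
    (forall t : 'I_n -> K, \sum_m c m * \prod_j t j ^+ m j = 0) ->
  forall m, c m = 0.
Proof.
move=> c0 m.
pose wt (m : {ffun 'I_n -> 'I_D}) := (\sum_(j < n) m j * D ^ j)%N.
have wt_inj : injective wt.
  move=> m1 m2 E; apply/ffunP => j; apply: val_inj => /=.
  pose ext (m : {ffun 'I_n -> 'I_D}) (k : nat) :=
    if insub k is Some k' then m k' : nat else 0%N.
  have extE m' (k : 'I_n) : ext m' k = m' k by rewrite /ext valK.
  rewrite -!extE; apply: (@digits_inj D n) (ltn_ord j).
    by move=> k lt_kn; rewrite -[k]/(val (Ordinal lt_kn)) !extE; split.
  by under eq_bigr do rewrite extE; under [RHS]eq_bigr do rewrite extE.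
have : \sum_m' c m' *: 'X^(wt m') = 0 :> {poly K}.
  apply: poly_eq0_fun => z _; rewrite horner_sum -[RHS](c0 (fun j => z ^+ (D ^ j))).
  apply: eq_bigr => m' _; rewrite hornerZ hornerXn; congr (_ * _).
  by rewrite -prodrXr; apply: eq_bigr => j _; rewrite -exprM mulnC.
move=> /(congr1 (fun p : {poly K} => p`_(wt m))).
rewrite coef0 coef_sum (bigD1 m) //= coefZ coefXn eqxx mulr1 big1 ?addr0 //.
by move=> m' ne; rewrite coefZ coefXn (inj_eq wt_inj) eq_sym (negPf ne) mulr0.
Qed.

Lemma mpoly_line N (p : {mpoly K[N]}) (v w : 'I_N -> K) :
  exists u : {poly K}, forall t, u.[t] = p.@[fun i => v i + t * w i].
Proof.
exists (\sum_(m <- msupp p) p@_m *: \prod_i ((v i)%:P + w i *: 'X) ^+ m i) => t.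
rewrite mevalE horner_sum; apply: eq_bigr => m _.
rewrite hornerZ horner_prod; congr (_ * _); apply: eq_bigr => i _.
by rewrite horner_exp hornerD hornerC hornerZ hornerX mulrC.
Qed.

Lemma dhomog_scale N (p : {mpoly K[N]}) d t (v : 'I_N -> K) :
  p \is d.-homog -> p.@[fun i => t * v i] = t ^+ d * p.@[v].
Proof.
move=> hp; rewrite !mevalE mulr_sumr !big_seq; apply: eq_bigr => m m_p.
rewrite mulrCA; congr (_ * _).
rewrite -(dhomog_mf hp m_p) /= mdegE -prodrXr -big_split /=.
by apply: eq_bigr => i _; rewrite exprMn.
Qed.

Lemma meval_pihomog N (p : {mpoly K[N]}) t (v : 'I_N -> K) :
  p.@[fun i => t * v i] = \sum_(d < msize p) t ^+ d * (pihomog mdeg d p).@[v].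
Proof.
rewrite {1}(pihomog_partitionE (leqnn (msize p))) raddf_sum /=.
by apply: eq_bigr => d _; apply: dhomog_scale (pihomogP _ _ _).
Qed.

Lemma pihomog_eq0 N (p : {mpoly K[N]}) (v : 'I_N -> K) :
    (forall t, t != 0 -> p.@[fun i => t * v i] = 0) ->
  forall d, (pihomog mdeg d p).@[v] = 0.
Proof.
move=> p0 d; have [lt_d|le_d] := ltnP d (msize p).
  apply: (@poly_coef0_fun (msize p) (fun d => (pihomog mdeg d p).@[v])) lt_d.
  by move=> t /p0; rewrite meval_pihomog.
rewrite pihomogE big_seq_cond big_pred0 ?meval0 // => m.
apply/negP => /andP[/msize_mdeg_lt lt_m /eqP eq_d].
by move: lt_m; rewrite ltnNge -eq_d in le_d *; rewrite le_d.
Qed.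

End PolynomialFunctions.

(** * Polynomial functions of a matrix *)

Section MatrixPolynomials.
Variables (K : numClosedFieldType) (n : nat).
Local Notation MP := {mpoly K[n * n]}.

(** Stated for functions rather than for elements of a polynomial ring, so that
    determinants and powers of matrices are polynomial without being written out
    in coordinates. *)
Definition polyfun (f : 'M[K]_n -> K) :=
  exists p : MP, forall X, f X = p.@[entries X].

Definition polymx m k (F : 'M[K]_n -> 'M[K]_(m, k)) :=
  forall i j, polyfun (fun X => F X i j).

Lemma entriesD t (X Y : 'M[K]_n) :
  entries (X + t *: Y) =1 (fun k => entries X k + t * entries Y k).
Proof. by move=> k; rewrite /entries linearD linearZ !mxE. Qed.

Lemma entriesZ t (X : 'M[K]_n) : entries (t *: X) =1 (fun k => t * entries X k).
Proof. by move=> k; rewrite /entries linearZ mxE. Qed.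

Lemma mx_neq0_entry (X : 'M[K]_n) : X != 0 -> exists i j, X i j != 0.
Proof.
move=> nzX; apply: contrapT => h; case/eqP: nzX; apply/matrixP => i j.
by rewrite [RHS]mxE; apply/eqP; apply: contraT => Xij; case: h; exists i, j.
Qed.

Lemma eq_polyfun f g : f =1 g -> polyfun f -> polyfun g.
Proof. by move=> eq_fg [p pE]; exists p => X; rewrite -eq_fg. Qed.

Lemma polyfun_cst c : polyfun (fun=> c).
Proof. by exists c%:MP => X; rewrite mevalC. Qed.

Lemma polyfun_entry i j : polyfun (fun X => X i j).
Proof. by exists 'X_(mxvec_index i j) => X; rewrite mevalXU /entries mxvecE. Qed.

Lemma polyfunD f g : polyfun f -> polyfun g -> polyfun (fun X => f X + g X).
Proof. by case=> p pE [q qE]; exists (p + q) => X; rewrite mevalD -pE -qE. Qed.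

Lemma polyfunM f g : polyfun f -> polyfun g -> polyfun (fun X => f X * g X).
Proof. by case=> p pE [q qE]; exists (p * q) => X; rewrite mevalM -pE -qE. Qed.

Lemma polyfun_sum I (r : seq I) (F : I -> 'M[K]_n -> K) :
  (forall i, polyfun (F i)) -> polyfun (fun X => \sum_(i <- r) F i X).
Proof.
move=> pF; elim: r => [|i r IHr].
  by apply: eq_polyfun (polyfun_cst 0) => X; rewrite big_nil.
by apply: eq_polyfun (polyfunD (pF i) IHr) => X; rewrite big_cons.
Qed.

Lemma polyfun_prod I (r : seq I) (F : I -> 'M[K]_n -> K) :
  (forall i, polyfun (F i)) -> polyfun (fun X => \prod_(i <- r) F i X).
Proof.
move=> pF; elim: r => [|i r IHr].
  by apply: eq_polyfun (polyfun_cst 1) => X; rewrite big_nil.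
by apply: eq_polyfun (polyfunM (pF i) IHr) => X; rewrite big_cons.
Qed.

Lemma polyfunX f k : polyfun f -> polyfun (fun X => f X ^+ k).
Proof.
move=> pf; apply: eq_polyfun (polyfun_prod (index_iota 0 k) (fun=> pf)) => X.
by rewrite prodr_const_nat subn0.
Qed.

Lemma polymx_cst m k (A : 'M[K]_(m, k)) : polymx (fun=> A).
Proof. by move=> i j; apply: polyfun_cst. Qed.

Lemma polymx_id : polymx id.
Proof. by move=> i j; apply: polyfun_entry. Qed.

Lemma polymxM m k l F G : polymx F -> polymx G ->
  polymx (fun X => (F X : 'M_(m, k)) *m (G X : 'M_(k, l))).
Proof.
move=> pF pG i j.
apply: eq_polyfun (polyfun_sum _ (fun a => polyfunM (pF i a) (pG a j))) => X.
by rewrite mxE.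
Qed.

Lemma polymxX (F : 'M[K]_n -> 'M[K]_n) k : polymx F -> polymx (fun X => F X ^+ k).
Proof.
move=> pF; elim: k => [|k IHk]; first exact: polymx_cst.
by move=> i j; apply: eq_polyfun (polymxM pF IHk i j) => X; rewrite exprS.
Qed.

Lemma polyfun_trace m F : polymx F -> polyfun (fun X => \tr (F X : 'M_m)).
Proof. by move=> pF; apply: polyfun_sum => i; apply: pF. Qed.

Lemma polyfun_det m F : polymx F -> polyfun (fun X => \det (F X : 'M_m)).
Proof.
move=> pF; apply: polyfun_sum => s; apply: polyfunM (polyfun_cst _) _.
by apply: polyfun_prod => i; apply: pF.
Qed.

Lemma polyfun_comp f F : polyfun f -> polymx F -> polyfun (fun X => f (F X)).
Proof.
case=> p pE pF.
suff: polyfun (fun X => p.@[entries (F X)]) by apply: eq_polyfun => X; rewrite pE.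
apply: (@eq_polyfun (fun X => \sum_(m <- msupp p) p@_m * \prod_k entries (F X) k ^+ m k)).
  by move=> X; rewrite mevalE.
apply: polyfun_sum => m; apply: polyfunM (polyfun_cst _) _.
apply: polyfun_prod => k; apply: polyfunX.
by case/mxvec_indexP: k => i j; apply: eq_polyfun (pF i j) => X; rewrite /entries mxvecE.
Qed.

(** The line through X1 and X2 meets each of the two zero sets in finitely many
    points, so a third point of it avoids both. *)
Lemma polyfun_nonzero2 (L : set 'M[K]_n) f g X1 X2 :
    (forall t X Y, L X -> L Y -> L (X + t *: (Y - X))) ->
    polyfun f -> polyfun g -> L X1 -> L X2 -> f X1 != 0 -> g X2 != 0 ->
  exists X, [/\ L X, f X != 0 & g X != 0].
Proof.
move=> lineL [p pE] [q qE] LX1 LX2 f1 g2.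
have [u uE] := mpoly_line p (entries X1) (entries (X2 - X1)).
have [v vE] := mpoly_line q (entries X1) (entries (X2 - X1)).
have uE' t : u.[t] = f (X1 + t *: (X2 - X1)).
  by rewrite uE pE; apply: meval_eq => k; rewrite entriesD.
have vE' t : v.[t] = g (X1 + t *: (X2 - X1)).
  by rewrite vE qE; apply: meval_eq => k; rewrite entriesD.
have nz_u : u != 0.
  by apply: contraNneq f1 => u0; have := uE' 0; rewrite u0 horner0 scale0r addr0 => <-.
have nz_v : v != 0.
  by apply: contraNneq g2 => v0; have := vE' 1; rewrite v0 horner0 scale1r addrC subrK => <-.
have [t uvt] : exists t, (u * v).[t] != 0.
  apply/not_existsP => h; have /eqP := mulf_neq0 nz_u nz_v; apply.
  by apply: poly_eq0_fun => t _; apply/eqP; apply: contraT => /h.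
exists (X1 + t *: (X2 - X1)); split; first exact: lineL.
  by rewrite -uE'; apply: contraNneq uvt => u0; rewrite hornerM u0 mul0r.
by rewrite -vE'; apply: contraNneq uvt => v0; rewrite hornerM v0 mulr0.
Qed.

End MatrixPolynomials.

(** * Closed sets of projective points *)

Section ProjectiveClosure.
Variables (K : numClosedFieldType) (n : nat).
Local Notation MP := {mpoly K[n * n]}.
Implicit Types (X Y : 'M[K]_n) (W A : set 'M[K]_n) (Z T : set {vspace 'M[K]_n}).

Lemma eq_vline X Y : X != 0 ->
  <[X]>%VS = <[Y]>%VS <-> exists2 c, c != 0 & Y = c *: X.
Proof.
move=> nzX; split=> [E|[c nzc ->]].
  have /vlineP[c cE] : X \in <[Y]>%VS by rewrite -E memv_line.
  have nzc : c != 0 by apply: contraNneq nzX => c0; rewrite cE c0 scale0r.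
  by exists c^-1; rewrite ?invr_eq0 // cE scalerK.
apply/vspaceP => V; apply/vlineP/vlineP => [[k ->]|[k ->]].
  by exists (k / c); rewrite scalerA mulfVK.
by exists (k * c); rewrite scalerA.
Qed.

Lemma vlineZ c X : c != 0 -> <[c *: X]>%VS = <[X]>%VS.
Proof.
move=> nzc; apply/vspaceP => V; apply/vlineP/vlineP => [[k ->]|[k ->]].
  by exists (k * c); rewrite scalerA.
by exists (k / c); rewrite scalerA mulfVK.
Qed.

(** Quantifying over all representatives of the points of Z makes this
    meaningful for inhomogeneous p: it vanishes on Z exactly when each of its
    homogeneous components does. *)
Definition vanishes (p : MP) Z :=
  forall X, X != 0 -> Z <[X]>%VS -> p.@[entries X] = 0.

Lemma vanishes_pihomog p Z d : vanishes p Z -> vanishes (pihomog mdeg d p) Z.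
Proof.
move=> p0 X nzX ZX; apply: pihomog_eq0 => t nzt.
have := p0 (t *: X); rewrite scaler_eq0 negb_or nzt nzX vlineZ // => /(_ isT ZX) <-.
by apply: meval_eq => k; rewrite entriesZ.
Qed.

Lemma meval_sum_pihomog (p : MP) X :
  (forall d, (pihomog mdeg d p).@[entries X] = 0) -> p.@[entries X] = 0.
Proof.
move=> p0; rewrite (pihomog_partitionE (leqnn (msize p))) raddf_sum /=.
by apply: big1 => d _.
Qed.

Definition scale_closed W := forall c X, W X -> W (c *: X).

Lemma symm_scale : scale_closed (@symm K n).
Proof. by move=> c X /= XE; rewrite /symm /= linearZ /= XE. Qed.

Lemma skew_scale : scale_closed (@skew K n).
Proof. by move=> c X /= XE; rewrite /skew /= linearZ /= XE scalerN. Qed.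

Lemma projP W X : scale_closed W -> X != 0 -> proj W <[X]>%VS <-> W X.
Proof.
move=> sW nzX; split=> [[Y [WY nzY] E]|WX]; last by exists X.
by have /(eq_vline _ nzY)[c _ ->] := E; apply: sW.
Qed.

Lemma zero_locusP W (F : set MP) X :
    scale_closed W -> (forall p, F p -> exists d, p \is d.-homog) -> X != 0 ->
  zero_locus W F <[X]>%VS <-> W X /\ forall p, F p -> p.@[entries X] = 0.
Proof.
move=> sW hF nzX; rewrite /zero_locus projP // => c Y [WY F0]; split; first exact: sW.
move=> p Fp; have [d hp] := hF p Fp; rewrite (meval_eq _ (entriesZ c Y)).
by rewrite (dhomog_scale _ _ hp) F0 ?mulr0.
Qed.

Lemma closed_rep W Z z : zariski_closed W Z -> Z z ->
  exists X, [/\ z = <[X]>%VS, X != 0 & W X].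
Proof. by case=> F hF -> [X [[WX _] nzX] <-]; exists X. Qed.

Lemma closed_sep W Z X : scale_closed W -> zariski_closed W Z ->
    W X -> X != 0 -> ~ Z <[X]>%VS ->
  exists p : MP, exists d, [/\ p \is d.-homog, vanishes p Z & p.@[entries X] != 0].
Proof.
move=> sW [F hF ->] WX nzX nZ.
have [[p Fp pX]|h] := pselect (exists2 p : MP, F p & p.@[entries X] != 0).
  have [d hp] := hF p Fp; exists p, d; split=> // Y nzY.
  by case/(zero_locusP sW hF nzY) => _ /(_ p Fp).
case: nZ; apply/(zero_locusP sW hF nzX); split=> // p Fp.
by apply/eqP; apply: contraT => pX; case: h; exists p.
Qed.

(** A cone cut out by arbitrary polynomials is cut out by their homogeneous components. *)
Lemma cone_closed W (G : set MP) : scale_closed W ->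
    (forall c X, c != 0 -> W X -> (forall p, G p -> p.@[entries X] = 0) ->
       forall p, G p -> p.@[entries (c *: X)] = 0) ->
  zariski_closed W (proj [set X | W X /\ forall p, G p -> p.@[entries X] = 0]).
Proof.
move=> sW scG; exists [set q | exists2 p, G p & exists d, q = pihomog mdeg d p].
  by move=> _ [p _ [d ->]]; exists d; apply: pihomogP.
apply/seteqP; split=> z [X [[WX G0] nzX] <-]; exists X => //; split=> //; split=> //.
  move=> _ [p Gp [d ->]]; apply: pihomog_eq0 => t nzt.
  by rewrite -(scG t X nzt WX G0 p Gp); apply: meval_eq => k; rewrite entriesZ.
by move=> p Gp; apply: meval_sum_pihomog => d; apply: G0; exists p => //; exists d.
Qed.

Lemma vanish_locus_closed W Z : scale_closed W ->
  zariski_closed W (proj [set X | W X /\ forall p, vanishes p Z -> p.@[entries X] = 0]).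
Proof.
move=> sW; apply: cone_closed => // c X nzc WX v0 p pZ.
rewrite (meval_eq _ (entriesZ c X)) meval_pihomog big1 // => d _.
by rewrite v0 ?mulr0 //; apply: vanishes_pihomog.
Qed.

(** The closure is cut out by all polynomials that vanish on Z: inhomogeneous ones
    may be used as well, since their homogeneous components vanish with them. *)
Lemma closureP W Z X : scale_closed W -> Z `<=` proj W -> X != 0 ->
  zariski_closure W Z <[X]>%VS <-> W X /\ forall p, vanishes p Z -> p.@[entries X] = 0.
Proof.
move=> sW ZW nzX; split=> [clX|[WX v0] T [Tcl ZT]]; last first.
  apply: contrapT => /(closed_sep sW Tcl WX nzX)[p [d [_ pT]]].
  by rewrite v0 ?eqxx // => Y nzY /ZT; apply: pT.
have scV : scale_closed [set X | W X /\ forall p, vanishes p Z -> p.@[entries X] = 0].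
  move=> c Y [WY v0]; split=> [|p pZ]; first exact: sW.
  rewrite (meval_eq _ (entriesZ c Y)) meval_pihomog big1 // => d _.
  by rewrite v0 ?mulr0 //; apply: vanishes_pihomog.
apply/(projP scV nzX); apply: clX; split; first exact: vanish_locus_closed.
move=> z Zz; have [Y [WY nzY] EY] := ZW _ Zz.
by exists Y => //; split=> //; split=> // p; apply; rewrite // EY.
Qed.

Lemma closure_closed W Z : scale_closed W -> Z `<=` proj W ->
  zariski_closed W (zariski_closure W Z).
Proof.
move=> sW ZW.
suff -> : zariski_closure W Z =
    proj [set X | W X /\ forall p, vanishes p Z -> p.@[entries X] = 0].
  exact: vanish_locus_closed.
apply/seteqP; split=> [z clz|z [X [[WX v0] nzX] <-]]; last by apply/closureP.
apply: clz; split; first exact: vanish_locus_closed.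
move=> y Zy; have [Y [WY nzY] EY] := ZW _ Zy.
by exists Y => //; split=> //; split=> // p; apply; rewrite // EY.
Qed.

Lemma sub_closure W Z : Z `<=` zariski_closure W Z.
Proof. by move=> z Zz T [_]; apply. Qed.

Lemma closure_sub W Z T : zariski_closed W T -> Z `<=` T -> zariski_closure W Z `<=` T.
Proof. by move=> clT ZT z; apply. Qed.

Lemma closure_mono W Z T : Z `<=` T -> zariski_closure W Z `<=` zariski_closure W T.
Proof. by move=> ZT z clz S [clS TS]; apply: clz; split=> // y /ZT/TS. Qed.

Lemma vanishes_closure W Z p : scale_closed W -> Z `<=` proj W ->
  vanishes p Z -> vanishes p (zariski_closure W Z).
Proof. by move=> sW ZW pZ X nzX /(closureP sW ZW nzX)[_]; apply. Qed.

(** Irreducible closed sets have prime vanishing ideals. Where the form f does not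
    vanish, h vanishes on the whole line, hence so do its components. *)
Lemma irreducible_mul W Z (f h : MP) d : scale_closed W ->
    irreducible_closed W Z -> f \is d.-homog -> vanishes (f * h) Z ->
  vanishes f Z \/ vanishes h Z.
Proof.
move=> sW [clZ _ irrZ] hf fhZ.
pose H : set MP := [set q | exists e, q = pihomog mdeg e h].
have hf1 p : [set f] p -> exists d, p \is d.-homog by move->; exists d.
have hH p : H p -> exists e, p \is e.-homog.
  by case=> e ->; exists e; apply: pihomogP.
case: (irrZ (zero_locus W [set f]) (zero_locus W H)).
- by exists [set f].
- by exists H.
- move=> z Zz; have [X [zE nzX WX]] := closed_rep clZ Zz; subst z.
  have [fX|fX] := eqVneq f.@[entries X] 0.
    by left; apply/zero_locusP => //; split=> // p ->.
  right; apply/zero_locusP => //; split=> // _ [e ->].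
  apply: pihomog_eq0 => t nzt.
  have := fhZ (t *: X); rewrite scaler_eq0 negb_or nzt nzX vlineZ // => /(_ isT Zz).
  rewrite (meval_eq _ (entriesZ t X)) mevalM (dhomog_scale _ _ hf) => /eqP.
  by rewrite !mulf_eq0 expf_eq0 (negPf nzt) (negPf fX) andbF => /eqP.
- by move=> ZT; left=> X nzX /ZT /(zero_locusP sW hf1 nzX)[_]; apply.
move=> ZT; right=> X nzX /ZT /(zero_locusP sW hH nzX)[_ H0].
by apply: meval_sum_pihomog => e; apply: H0; exists e.
Qed.

End ProjectiveClosure.

(** * Counting independent polynomials *)

Section Counting.
Variable K : numClosedFieldType.

(** A box of side D in dimension m + 1 outgrows the monomials of degree O(D) in m
    variables; all dimension counts below come down to this. *)
Lemma exists_large_box E m : exists D, ((2 * (E * D)).+1 ^ m < D ^ m.+1)%N.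
Proof.
have leD D : (0 < D -> (2 * (E * D)).+1 <= (2 * E).+1 * D)%N by nia.
exists ((2 * E).+1 ^ m).+1; apply: (@leq_ltn_trans ((2 * E).+1 ^ m * ((2 * E).+1 ^ m).+1 ^ m)%N).
  by rewrite -expnMn; case: (m) => // m'; rewrite leq_exp2r ?leD.
by rewrite expnS ltn_pmul2r ?expn_gt0.
Qed.

Lemma msize_mul N (p q : {mpoly K[N]}) a b :
  (msize p <= a.+1 -> msize q <= b.+1 -> msize (p * q) <= (a + b).+1)%N.
Proof.
move=> pa qb; have [->|nzp] := eqVneq p 0; first by rewrite mul0r msize0.
have [->|nzq] := eqVneq q 0; first by rewrite mulr0 msize0.
rewrite msizeM //; move: (msize p) (msize q) pa qb => x y; lia.
Qed.

Lemma msize_exp N (p : {mpoly K[N]}) a k :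
  (msize p <= a.+1 -> msize (p ^+ k) <= (a * k).+1)%N.
Proof.
move=> pa; elim: k => [|k IHk]; first by rewrite expr0 msize1.
by rewrite exprS mulnS; apply: msize_mul.
Qed.

Lemma msize_prod N I (r : seq I) (p : I -> {mpoly K[N]}) a :
  (forall i, msize (p i) <= (a i).+1)%N ->
  (msize (\prod_(i <- r) p i) <= (\sum_(i <- r) a i).+1)%N.
Proof.
move=> pa; elim: r => [|i r IHr]; first by rewrite !big_nil msize1.
by rewrite !big_cons; apply: msize_mul.
Qed.

Lemma msize_sum_le N I (r : seq I) (P : pred I) (p : I -> {mpoly K[N]}) b :
  (forall i, P i -> msize (p i) <= b)%N ->
  (msize (\sum_(i <- r | P i) p i) <= b)%N.
Proof.
move=> pb; apply: (big_ind (fun p : {mpoly K[N]} => msize p <= b)%N) => //.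
  by rewrite msize0.
by move=> x y xb yb; apply: leq_trans (mmeasureD_le _ _ _) _; rewrite geq_max xb yb.
Qed.

Lemma card_bmultinom m B : (#|{: 'X_{1..m < B}}| <= B ^ m)%N.
Proof.
have lt_B (x : 'X_{1..m < B}) i : (x i < B)%N.
  by apply: leq_ltn_trans (bmdeg x); rewrite mdegE (bigD1 i) //= leq_addr.
pose F (x : 'X_{1..m < B}) := [ffun i : 'I_m => Ordinal (lt_B x i)].
have F_inj : injective F.
  move=> x y /ffunP E; apply/val_inj/mnmP => i.
  by have := E i; rewrite !ffunE => -[].
by have := leq_card F F_inj; rewrite card_ffun !card_ord.
Qed.

Lemma mpoly_dependent m B (I : finType) (g : I -> {mpoly K[m]}) :
    (forall i, msize (g i) <= B)%N -> (B ^ m < #|I|)%N ->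
  exists2 c : I -> K, \sum_i c i *: g i = 0 & exists i, c i != 0.
Proof.
move=> gB lt_I; set J : finType := 'X_{1..m < B}.
pose M := \matrix_(i < #|I|, j < #|J|) (g (enum_val i))@_(enum_val j : 'X_{1..m < B}).
have: kermx M != 0.
  rewrite -mxrank_eq0 mxrank_ker -lt0n subn_gt0.
  exact: leq_ltn_trans (rank_leq_col M) (leq_ltn_trans (card_bmultinom m B) lt_I).
case/rowV0Pn => v /sub_kermxP vM nz_v.
exists (fun i => v 0 (enum_rank i)); last first.
  have /existsP[k vk] : [exists k, v 0 k != 0].
    apply: contraNT nz_v; rewrite negb_exists => /forallP v0; apply/eqP/rowP => k.
    by apply/eqP; rewrite mxE; have := v0 k; rewrite negbK.
  by exists (enum_val k); rewrite enum_valK.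
apply/mpolyP => x; rewrite mcoeff0 raddf_sum /=.
have [lt_x|le_x] := ltnP (mdeg x) B; last first.
  apply: big1 => i _; rewrite mcoeffZ [(g i)@_x]memN_msupp_eq0 ?mulr0 //.
  exact: msize_mdeg_ge (leq_trans (gB i) le_x).
have := congr1 (fun u : 'rV_#|J| => u 0 (enum_rank (BMultinom lt_x))) vM.
rewrite !mxE => vM0; rewrite -[RHS]vM0 (reindex (@enum_val I predT)) /=; last first.
  by apply: onW_bij; apply: enum_val_bij.
by apply: eq_bigr => k _; rewrite mcoeffZ enum_valK mxE enum_rankK.
Qed.

End Counting.

(** * Upper bound for the length of chains *)

Section UpperBound.
Variables (K : numClosedFieldType) (n : nat).
Local Notation MP := {mpoly K[n * n]}.
Implicit Types (X Y : 'M[K]_n) (W C : set 'M[K]_n) (Z V : set {vspace 'M[K]_n}).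

Definition indep C (I : finType) (g : I -> MP) :=
  forall c : I -> K,
    (forall X, C X -> (\sum_i c i *: g i).@[entries X] = 0) -> forall i, c i = 0.

(** A growth condition standing for the existence of k algebraically independent
    polynomial functions on C: D ^ k independent polynomials of degree O(D), to be
    thought of as the monomials with exponents less than D in these functions. *)
Definition growth C k :=
  exists E, forall D, exists (I : finType) (g : I -> MP),
    [/\ #|I| = (D ^ k)%N, forall i, (msize (g i) <= (E * D).+1)%N & indep C g].

(** The origin belongs to the cone, so that a chain of closed sets can be started
    one step earlier, from the origin alone. *)
Definition cone Z : set 'M[K]_n := [set X | X = 0 \/ (X != 0 /\ Z <[X]>%VS)].

Lemma vanishes_at0 (p : MP) Z X : X != 0 -> Z <[X]>%VS -> vanishes p Z ->
  p.@[entries 0] = 0.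
Proof.
move=> nzX ZX pZ; rewrite -(scale0r X) (meval_eq _ (entriesZ 0 X)) meval_pihomog.
by apply: big1 => d _; rewrite (@vanishes_pihomog K n p Z d pZ) ?mulr0.
Qed.

Lemma vanishes_cone (p : MP) Z : Z !=set0 -> Z `<=` proj setT ->
  vanishes p Z <-> forall X, cone Z X -> p.@[entries X] = 0.
Proof.
move=> [z Zz] ZW; have [Y [_ nzY] zE] := ZW z Zz; subst z.
split=> [pZ X [->|[nzX ZX]]|pC X nzX ZX]; last by apply: pC; right.
  exact: vanishes_at0 nzY Zz pZ.
exact: pZ.
Qed.

Lemma closed_proj W Z : zariski_closed W Z -> Z `<=` proj setT.
Proof. by move=> cl z /(closed_rep cl)[X [-> nzX _]]; exists X. Qed.

(** If f vanishes on C but not on the irreducible set Z, then multiplying by the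
    powers of f turns the independent polynomials on C into a basis of a free
    module over the polynomials in f on Z. *)
Lemma growth_step W C Z k (f : MP) d : scale_closed W -> irreducible_closed W Z ->
    C `<=` cone Z -> f \is d.-homog -> (forall X, C X -> f.@[entries X] = 0) ->
    ~ vanishes f Z -> growth C k ->
  growth (cone Z) k.+1.
Proof.
move=> sW irrZ CZ hf fC nfZ [E gr]; have [clZ nZ _] := irrZ.
have coneP p := vanishes_cone p nZ (closed_proj clZ).
exists (msize f + E)%N => D; have [I [g [cardI sz_g ind_g]]] := gr D.
exists (I * 'I_D)%type, (fun ij : I * 'I_D => f ^+ ij.2 * g ij.1); split.
- by rewrite card_prod card_ord cardI expnSr.
- move=> [i j] /=; have lt_j := ltn_ord j.
  apply: leq_trans (msize_mul (msize_exp j (leqnSn _)) (sz_g i)) _.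
  by rewrite mulnDl ltnS leq_add2r leq_mul2l (ltnW lt_j) orbT.
have freeD (a : nat -> I -> K) : vanishes (\sum_(j < D) f ^+ j * \sum_i a j i *: g i) Z ->
    forall j, (j < D)%N -> forall i, a j i = 0.
  elim: (D) a => [//|D' IH] a; rewrite big_ord_recl expr0 mul1r.
  under [X in _ + X]eq_bigr do rewrite lift0 exprS -mulrA; rewrite -mulr_sumr /= => vanH.
  have a0 : forall i, a 0%N i = 0.
    apply: ind_g => X CX; have := (coneP _).1 vanH X (CZ _ CX).
    by rewrite mevalD mevalM fC // mul0r addr0.
  move: vanH; rewrite big1 ?add0r => [|i _]; last by rewrite a0 scale0r.
  case/(irreducible_mul sW irrZ hf) => // /(IH (fun j => a j.+1)) as0.
  by case=> [_ //|j lt_j]; apply: as0.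
move=> c c0 [i j].
have := freeD (fun j i => if insub j is Some j' then c (i, j') else 0).
move=> /(_ _ j (ltn_ord j) i); rewrite valK; apply; apply/coneP => X ZX.
rewrite -[RHS](c0 X ZX); congr (_.@[_]).
have -> : \sum_ij c ij *: (f ^+ ij.2 * g ij.1) =
    \sum_i \sum_(j < D) c (i, j) *: (f ^+ j * g i).
  by rewrite pair_bigA; apply: eq_bigr => -[].
rewrite exchange_big /=; apply: eq_bigr => l _; rewrite mulr_sumr.
by apply: eq_bigr => i' _; rewrite valK scalerAr.
Qed.

(** Each step of a chain contributes a form vanishing on the smaller set but not on
    the larger one; for the step from the origin any nonzero coordinate will do. *)
Lemma growth_chain W V k c : scale_closed W -> irreducible_chain W V k c ->
  growth (if k is k'.+1 then cone (c k') else [set 0]) k.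
Proof.
move=> sW; elim: k => [|k IHk] [irr_c lt_c].
  exists 0%N => D; exists unit, (fun=> 1); split; first by rewrite card_unit.
    by move=> _; rewrite msize1.
  move=> a /(_ 0 erefl); rewrite (bigD1 tt) //= big1 ?addr0 => [|[]//].
  by rewrite mevalZ meval1 mulr1 => a0 [].
have [irr_k _] := irr_c k (ltnSn k); have [clk nk _] := irr_k.
have {}IHk : growth (if k is k'.+1 then cone (c k') else [set 0]) k.
  by apply: IHk; split=> i lt_i; [apply: irr_c|apply: lt_c]; apply: leqW.
case: k => [|k] in irr_c lt_c irr_k clk nk IHk *.
  have [z cz] := nk; have [X [zE nzX _]] := closed_rep clk cz; subst z.
  have [i [j Xij]] := mx_neq0_entry nzX.
  apply: (growth_step (f := 'X_(mxvec_index i j)) (d := 1) sW irr_k _ _ _ _ IHk).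
  - by move=> _ ->; left.
  - by rewrite dhomogX /= mdeg1.
  - by move=> _ ->; rewrite mevalXU /entries mxvecE mxE.
  by move=> /(_ X nzX cz); rewrite mevalXU /entries mxvecE; apply/eqP.
have [sub_c nsub_c] := lt_c k (ltnSn k.+1).
have [irr_k' _] := irr_c k (leqnSn _); have [clk' nk' _] := irr_k'.
have [X [nzX WX cX ncX]] : exists X, [/\ X != 0, W X, c k.+1 <[X]>%VS & ~ c k <[X]>%VS].
  apply: contrapT => h; apply: nsub_c => z cz; apply: contrapT => ncz.
  by have [X [zE nzX WX]] := closed_rep clk cz; case: h; exists X; rewrite -zE.
have [f [d [hf f0 fX]]] := closed_sep sW clk' WX nzX ncX.
apply: (growth_step sW irr_k _ hf _ _ IHk).
- by move=> Y [->|[nzY cY]]; [left|right; split=> //; apply: sub_c].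
- exact/(vanishes_cone _ nk' (closed_proj clk')).
by move=> /(_ X nzX cX); apply/eqP.
Qed.

Definition combi m (H : 'I_m -> 'M[K]_n) (t : 'I_m -> K) := \sum_i t i *: H i.

Definition lincomb m (H : 'I_m -> 'M[K]_n) : set 'M[K]_n := [set combi H t | t in setT].

(** The squares of the matrices in an m-dimensional space are parametrized by m
    variables, which bounds the number of independent polynomials on them. *)
Lemma squares_dependent m (H : 'I_m -> 'M[K]_n) (I : finType) (g : I -> MP) b :
    (forall i, msize (g i) <= b.+1)%N -> ((2 * b).+1 ^ m < #|I|)%N ->
  exists2 c : I -> K, exists i, c i != 0 &
    forall X, lincomb H X -> (\sum_i c i *: g i).@[entries (X ^+ 2)] = 0.
Proof.
move=> gb lt_I.
pose T i j : {mpoly K[m]} := \sum_l H l i j *: 'X_l.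
have TE i j (t : 'I_m -> K) : (T i j).@[t] = (combi H t) i j.
  rewrite /T raddf_sum summxE /=; apply: eq_bigr => l _.
  by rewrite mevalZ mevalXU !mxE mulrC.
have sz_T i j : (msize (T i j) <= 2)%N.
  apply: msize_sum_le => l _; apply: leq_trans (msizeZ_le _ _) _.
  by rewrite msizeX mdeg1.
pose Q : (n * n).-tuple {mpoly K[m]} :=
  [tuple mxvec (\matrix_(i, j) \sum_l T i l * T l j) 0 k | k < n * n].
have QE (t : 'I_m -> K) k : (tnth Q k).@[t] = entries (combi H t ^+ 2) k.
  rewrite tnth_mktuple /entries; case/mxvec_indexP: k => i j; rewrite !mxvecE !mxE.
  by rewrite raddf_sum /=; apply: eq_bigr => l _; rewrite mevalM !TE.
have sz_Q k : (msize (tnth Q k) <= 3)%N.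
  rewrite tnth_mktuple; case/mxvec_indexP: k => i j; rewrite mxvecE mxE.
  by apply: msize_sum_le => l _; apply: (msize_mul (a := 1) (b := 1)).
have sz_comp i : (msize (g i \mPo Q) <= (2 * b).+1)%N.
  rewrite comp_mpolyEX big_seq; apply: msize_sum_le => x xg.
  apply: leq_trans (msizeZ_le _ _) _; rewrite comp_mpolyX.
  apply: leq_trans (msize_prod (a := fun k => (2 * x k)%N) _ _) _.
    by move=> k; apply: msize_exp.
  rewrite -big_distrr /= -mdegE ltnS leq_mul2l /= -ltnS.
  exact: leq_trans (msize_mdeg_lt xg) (gb i).
have [c c0 nzc] := mpoly_dependent sz_comp lt_I.
exists c => // _ [t _ <-].
have := congr1 (fun p : {mpoly K[m]} => p.@[t]) c0; rewrite meval0 => <-.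
rewrite !raddf_sum /=; apply: eq_bigr => i _; rewrite !mevalZ comp_mpoly_meval.
by congr (_ * _); apply: meval_eq => k; rewrite QE.
Qed.

Definition sq_closure (L : set 'M[K]_n) : set {vspace 'M[K]_n} :=
  zariski_closure symm (@proj K n [set X ^+ 2 | X in L]).

Lemma sq_skew X : skew X -> symm (X ^+ 2).
Proof. by move=> XE; rewrite /symm /= expr2 -[X * X]/(X *m X) trmx_mul XE mulmxN mulNmx opprK. Qed.

Lemma proj_sq_symm L : L `<=` skew -> @proj K n [set X ^+ 2 | X in L] `<=` proj symm.
Proof. by move=> Lskew _ [_ [[X LX <-] nz] <-]; exists (X ^+ 2) => //; split=> //; apply/sq_skew/Lskew. Qed.

Lemma sq_closure_mono L L' : L `<=` L' -> sq_closure L `<=` sq_closure L'.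
Proof.
by move=> LL'; apply: closure_mono => _ [_ [[X LX <-] nz] <-]; exists (X ^+ 2) => //; split=> //; exists X => //; apply: LL'.
Qed.

Lemma sqmxZ a X : (a *: X) ^+ 2 = a ^+ 2 *: X ^+ 2.
Proof. by rewrite !expr2 -!mulmxE -scalemxAl -scalemxAr scalerA. Qed.

(** A polynomial vanishing on the squares vanishes on their multiples, since c X ^+ 2 is
    the square of sqrt c X, and then on the cone over their closure. *)
Lemma vanish_sq_cone (p : MP) L : scale_closed L -> L `<=` skew -> (exists2 X, L X & X ^+ 2 != 0) ->
    (forall X, L X -> p.@[entries (X ^+ 2)] = 0) ->
  forall X, cone (sq_closure L) X -> p.@[entries X] = 0.
Proof.
move=> sL Lskew [X0 LX0 nz0] p0.
have pL : vanishes p (@proj K n [set X ^+ 2 | X in L]).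
  move=> X nzX [Y [[U LU UY] nzY] /(eq_vline _ nzY)[c nzc ->]].
  have := @sqrtCK K c; set e := sqrtC c => eE.
  by rewrite -eE -UY -sqmxZ p0 //; apply: sL.
have pS : vanishes p (sq_closure L).
  by apply: vanishes_closure pL; [apply: symm_scale|apply: proj_sq_symm].
move=> X [->|[nzX SX]]; last exact: pS.
apply: (vanishes_at0 nz0 _ pS); apply: (@sub_closure K n).
by exists (X0 ^+ 2) => //; split; [exists X0|].
Qed.

End UpperBound.

(** * Chains of irreducible sets of squares *)

Section LowerBound.
Variables (K : numClosedFieldType) (n : nat).
Local Notation MP := {mpoly K[n * n]}.
Implicit Types (X Y : 'M[K]_n) (L : set 'M[K]_n).

Lemma combiD m (H : 'I_m -> 'M[K]_n) t s a :
  combi H (fun i => t i + a * s i) = combi H t + a *: combi H s.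
Proof.
rewrite /combi scaler_sumr -big_split /=; apply: eq_bigr => i _.
by rewrite scalerDl scalerA.
Qed.

(** Near X0 the coordinates of X ^+ 2, in the directions of the image of the
    differential, are the coordinates of X - X0 up to quadratic terms; the lowest
    order part of a relation between them is a relation between monomials. *)
Lemma squares_free k (H : 'I_k -> 'M[K]_n) X0 D : lincomb H X0 ->
    (forall t, X0 * combi H t + combi H t * X0 = 0 -> forall i, t i = 0) ->
  exists2 g : {ffun 'I_k -> 'I_D} -> MP, forall m, (msize (g m) <= (k * D).+1)%N &
    forall c : {ffun 'I_k -> 'I_D} -> K,
      (forall X, lincomb H X -> (\sum_m c m *: g m).@[entries (X ^+ 2)] = 0) ->
    forall m, c m = 0.
Proof.
move=> [t0 _ X0E] inj_d.
pose M := \matrix_(i < k) mxvec (X0 * H i + H i * X0).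
have ME (t : 'I_k -> K) :
    (\row_i t i) *m M = mxvec (X0 * combi H t + combi H t * X0).
  rewrite mulmx_sum_row mulr_sumr mulr_suml -big_split raddf_sum /=.
  apply: eq_bigr => i _; rewrite rowK mxE -linearZ /=; congr mxvec.
  by rewrite -!mulmxE -scalemxAl -scalemxAr scalerDr.
have freeM : row_free M.
  rewrite -kermx_eq0; apply/eqP/row_matrixP => i; rewrite row0.
  have := mulmx_ker M => /(congr1 (row i)); rewrite row_mul row0.
  set v := row i _; have -> : v = \row_j v 0 j by apply/rowP => j; rewrite mxE.
  rewrite ME => /(canRL (@mxvecK _ _ _)); rewrite linear0 => /inj_d v0.
  by apply/rowP => j; rewrite [LHS]mxE [RHS]mxE v0.
(* R gives linear forms dual to the images X0 H_i + H_i X0 under the differential. *)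
pose R := pinvmx M.
pose y j : MP := \sum_l R l j *: 'X_l - ((mxvec (X0 ^+ 2) *m R) 0 j)%:MP.
have yE j Y : (y j).@[entries Y] = (mxvec (Y - X0 ^+ 2) *m R) 0 j.
  rewrite mevalB mevalC raddf_sum /= raddfB /= mulmxBl !mxE; congr (_ - _).
  by apply: eq_bigr => l _; rewrite mevalZ mevalXU mulrC.
have sz_y j : (msize (y j) <= 2)%N.
  rewrite /y -mpolyCN; apply: leq_trans (mmeasureD_le _ _ _) _.
  rewrite geq_max mmeasureC; apply/andP; split; last by case: (_ != _).
  apply: msize_sum_le => l _; apply: leq_trans (msizeZ_le _ _) _.
  by rewrite msizeX mdeg1.
exists (fun m : {ffun 'I_k -> 'I_D} => \prod_j y j ^+ m j) => [m|c c0].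
  apply: leq_trans (msize_prod (a := fun j => (m j : nat)) _ _) _.
    by move=> j; rewrite -[X in X.+1]mul1n; apply: msize_exp.
  rewrite ltnS -[X in (_ <= X * _)%N]card_ord -sum_nat_const.
  by apply: leq_sum => j _; apply: ltnW.
apply: contrapT => /existsNP[m0 /eqP nzm0].
pose wt (m : {ffun 'I_k -> 'I_D}) := (\sum_j m j)%N.
(* Along the line X0 + s T the relation, divided by the power of s in its terms of
   lowest weight, becomes at s = 0 a relation between monomials in the t j. *)
pose m1 := [arg min_(m < m0 | c m != 0) wt m].
have [nzm1 min_m1] : c m1 != 0 /\ forall m, c m != 0 -> (wt m1 <= wt m)%N.
  by rewrite /m1; case: arg_minnP.
have := @monomials_free K k D (fun m => c m * 0 ^+ (wt m - wt m1)).
move=> h; move: (nzm1); rewrite -[c m1]mulr1 -(expr0 0) -(subnn (wt m1)) h ?eqxx //.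
move=> t; pose T := combi H t; pose Q j := (mxvec (T ^+ 2) *m R) 0 j.
pose u : {poly K} :=
  \sum_m c m *: ('X^(wt m - wt m1) * \prod_j ((t j)%:P + Q j *: 'X) ^+ m j).
have : u = 0.
  apply: poly_eq0_fun => s nzs; apply: (mulfI (expf_neq0 (wt m1) nzs)).
  rewrite mulr0 -[RHS](c0 (X0 + s *: T)); last first.
    by exists (fun i => t0 i + s * t i) => //; rewrite combiD X0E.
  rewrite horner_sum mulr_sumr raddf_sum /=; apply: eq_bigr => m _.
  rewrite hornerZ mevalZ; have [->|nzm] := eqVneq (c m) 0; first by rewrite !mul0r mulr0.
  rewrite mulrCA; congr (_ * _); rewrite hornerM hornerXn mulrA -exprD subnKC ?min_m1 //.
  rewrite horner_prod rmorph_prod /wt -prodrXr -big_split /=; apply: eq_bigr => j _.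
  rewrite horner_exp rmorphXn /= -exprMn yE; congr (_ ^+ _).
  rewrite !hornerE.
  have -> : (X0 + s *: T) ^+ 2 - X0 ^+ 2 = s *: (X0 * T + T * X0) + (s ^+ 2) *: T ^+ 2.
    rewrite !expr2 mulrDl !mulrDr -!mulmxE -!scalemxAl -!scalemxAr scalerA scalerDr.
    by rewrite !addrA [_ + s *: (T *m X0)]addrAC addrAC [_ - _]addrC !addrA addNr add0r addrAC.
  have addE (A B : 'rV[K]_k) a b : (a *: A + b *: B) 0 j = a * A 0 j + b * B 0 j.
    by rewrite !mxE.
  rewrite linearD !linearZ /= -ME mulmxDl -!scalemxAl -mulmxA mulmxVp // mulmx1 addE mxE.
  by rewrite -/(Q j) mulrDr [_ * s]mulrC mulrA -expr2.
move=> /(congr1 (fun p : {poly K} => p.[0])); rewrite horner0 horner_sum => u0; rewrite -[RHS]u0.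
apply: eq_bigr => m _; rewrite hornerZ hornerM hornerXn -mulrA horner_prod.
congr (_ * (_ * _)); apply: eq_bigr => j _.
by rewrite horner_exp !hornerE ?mulr0 ?addr0.
Qed.

End LowerBound.

(** * Dimension of the closure of a set of squares *)

Section SquareDimension.
Variables (K : numClosedFieldType) (n : nat).
Local Notation MP := {mpoly K[n * n]}.
Implicit Types (X Y : 'M[K]_n) (L : set 'M[K]_n).

Lemma lincomb_line m (H : 'I_m -> 'M[K]_n) t X Y :
  lincomb H X -> lincomb H Y -> lincomb H (X + t *: (Y - X)).
Proof.
case=> x _ <- [y _ <-]; exists (fun i => x i + t * (y i + (-1) * x i)) => //.
by rewrite !combiD scaleN1r.
Qed.

Lemma lincomb_scale m (H : 'I_m -> 'M[K]_n) : scale_closed (lincomb H).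
Proof.
move=> c _ [t _ <-]; exists (fun i => c * t i) => //.
by rewrite /combi scaler_sumr; apply: eq_bigr => i _; rewrite scalerA.
Qed.

(** The closure of the image of an irreducible set is irreducible, here for an affine
    space of matrices, any two points of which lie on a line. *)
Lemma irreducible_sq L : L `<=` skew ->
    (forall t X Y, L X -> L Y -> L (X + t *: (Y - X))) ->
    (exists2 X, L X & X ^+ 2 != 0) ->
  irreducible_closed symm (sq_closure L).
Proof.
move=> Lskew lineL [X0 LX0 nz0]; have sS := @symm_scale K n.
have inS X : L X -> X ^+ 2 != 0 -> sq_closure L <[X ^+ 2]>%VS.
  by move=> LX nz; apply: (@sub_closure K n); exists (X ^+ 2) => //; split=> //; exists X.
split; first by apply: closure_closed => //; apply: proj_sq_symm.
  by exists <[X0 ^+ 2]>%VS; apply: inS.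
move=> T1 T2 cl1 cl2 T12; apply: contrapT => /not_orP[n1 n2].
have sep T : zariski_closed symm T -> ~ (sq_closure L `<=` T) ->
    exists p X, [/\ L X, X ^+ 2 != 0, vanishes p T & p.@[entries (X ^+ 2)] != 0].
  move=> clT nT; apply: contrapT => h; apply: nT; apply: closure_sub => //.
  move=> _ [Y [[X LX <-] nzX] <-]; apply: contrapT => nTX.
  have [p [d [_ pT pX]]] := closed_sep sS clT (sq_skew (Lskew X LX)) nzX nTX.
  by case: h; exists p, X.
have [p1 [X1 [LX1 nz1 v1 p1X]]] := sep T1 cl1 n1.
have [p2 [X2 [LX2 _ v2 p2X]]] := sep T2 cl2 n2.
(* An entry of X ^+ 2 is multiplied in, to find a point where X ^+ 2 is not 0. *)
have [i [j Xij]] := mx_neq0_entry nz1.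
have pSq : polymx (fun X : 'M[K]_n => X ^+ 2) by apply: polymxX; apply: polymx_id.
have pP (p : MP) : polyfun (fun X : 'M[K]_n => p.@[entries (X ^+ 2)]).
  by apply: (polyfun_comp (f := fun X => p.@[entries X])) => //; exists p.
have [|X [LX]] := polyfun_nonzero2 lineL (polyfunM (pP p1) (pSq i j)) (pP p2) LX1 LX2 _ p2X.
  by rewrite mulf_neq0.
rewrite mulf_eq0 negb_or => /andP[pX Xij0] qX.
have nzX : X ^+ 2 != 0 by apply: contraNneq Xij0 => ->; rewrite mxE.
have [/(v1 _ nzX)/eqP|/(v2 _ nzX)/eqP] := T12 _ (inS X LX nzX).
  by rewrite (negPf pX).
by rewrite (negPf qX).
Qed.

(** If the closures coincided, the D ^ m independent polynomials of degree at most
    m D on the squares of the m-dimensional space would be independent on the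
    squares of the k-dimensional one, which carry only O(D ^ k) of them. *)
Lemma sq_closure_strict k m (H : 'I_k -> 'M[K]_n) (G : 'I_m -> 'M[K]_n) X0 :
    (k < m)%N -> lincomb G `<=` skew -> lincomb H `<=` skew ->
    (exists2 X, lincomb H X & X ^+ 2 != 0) -> lincomb G X0 ->
    (forall t, X0 * combi G t + combi G t * X0 = 0 -> forall i, t i = 0) ->
  ~ (sq_closure (lincomb G) `<=` sq_closure (lincomb H)).
Proof.
move=> lt_km Gskew Hskew nzH GX0 injG sub_GH.
have [D ltD] := exists_large_box m k.
have [g sz_g free_g] := squares_free D GX0 injG.
have [|c [i nzc] c0] := squares_dependent H (b := (m * D)%N) sz_g.
  rewrite card_ffun !card_ord; apply: (leq_trans ltD).
  by rewrite leq_pexp2l // lt0n; apply: contraTneq ltD => ->; rewrite exp0n // ltn0.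
case/eqP: nzc; apply: free_g => X GX.
have [-> |nzX] := eqVneq (X ^+ 2) 0.
  have L0 : lincomb H 0 by exists (fun=> 0) => //; rewrite /combi big1 // => j _; rewrite scale0r.
  by rewrite -(c0 _ L0) expr2 mul0r.
apply: vanish_sq_cone Hskew nzH c0 _ _; first exact: lincomb_scale.
right; split=> //; apply: sub_GH; apply: (@sub_closure K n).
by exists (X ^+ 2) => //; split=> //; exists X.
Qed.

(** A chain of k sets needs D ^ k independent polynomials of degree O(D), while the
    squares of an m-dimensional space carry only O(D ^ m) of them. *)
Lemma chain_length m (H : 'I_m -> 'M[K]_n) k c :
    lincomb H `<=` skew -> (exists2 X, lincomb H X & X ^+ 2 != 0) ->
    irreducible_chain symm (sq_closure (lincomb H)) k c ->
  (k <= m)%N.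
Proof.
move=> Hskew nzH chain_c; rewrite leqNgt; apply/negP => lt_mk.
have := growth_chain (@symm_scale K n) chain_c.
case: k => // k in chain_c lt_mk *; case=> E gr.
have [D ltD] := exists_large_box E m; have [I [g [cardI sz_g ind_g]]] := gr D.
have [|a [i nza] a0] := squares_dependent H (b := (E * D)%N) sz_g.
  rewrite cardI; apply: (leq_trans ltD).
  by rewrite leq_pexp2l // lt0n; apply: contraTneq ltD => ->; rewrite exp0n // ltn0.
case/eqP: nza; apply: ind_g => X cX.
apply: vanish_sq_cone Hskew nzH a0 _ _; first exact: lincomb_scale.
have [_ sub_c] := chain_c.1 k (ltnSn k).
by case: cX => [->|[nzX cX]]; [left|right; split=> //; apply: sub_c].
Qed.

Lemma basis_extending (V : {vspace 'M[K]_n}) X : X \in V -> X != 0 ->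
  exists2 b : (\dim V).-tuple 'M[K]_n, basis_of V b & b`_0 = X.
Proof.
move=> VX nzX; have bV : basis_of V (X :: vbasis (V :\: <[X]>)).
  have VE : V = (<[X]> + (V :\: <[X]>))%VS.
    by rewrite addvC addv_diff; apply/esym/addv_idPl; rewrite -memvE.
  rewrite [in X in basis_of X _]VE.
  rewrite -cat1s; apply: cat_basis (seq1_basis nzX) (vbasisP _).
  by apply/directv_addP; rewrite capvC capv_diff.
have sz : size (X :: vbasis (V :\: <[X]>)) == \dim V.
  by rewrite [X in _ == X](@vector.size_basis _ _ V _ (in_tuple _) bV).
by exists (Tuple sz).
Qed.

(** The closures of the squares of the members of a flag through X0 form a chain of
    the largest possible length: at X0 the squaring map is an immersion, so
    each of them has the dimension of the space of matrices that are squared. *)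
Lemma sq_dimension (V : {vspace 'M[K]_n}) X0 : (forall X, X \in V -> skew X) ->
    X0 \in V -> X0 ^+ 2 != 0 ->
    (forall H, H \in V -> X0 * H + H * X0 = 0 -> H = 0) ->
  has_dimension symm (sq_closure [set X | X \in V]) ((\dim V)%:Z - 1).
Proof.
move=> Vskew VX0 nz0 injV.
have nzX0 : X0 != 0 by apply: contraNneq nz0 => ->; rewrite expr2 mul0r.
have [b bV b0] := basis_extending VX0 nzX0; set m := \dim V.
have m_gt0 : (0 < m)%N by rewrite lt0n dimv_eq0; apply: contraNneq nzX0 => V0; rewrite V0 memv0 in VX0.
pose H k (i : 'I_k) := b`_i.
pose ext k (t : 'I_k -> K) i := if insub i is Some j then t j else 0.
have extE k (t : 'I_k -> K) (i : 'I_k) : ext k t i = t i by rewrite /ext valK.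
have combiE k l (t : 'I_k -> K) : (k <= l)%N ->
    combi (@H k) t = combi (@H l) (fun i => ext k t i).
  move=> le_kl; rewrite /combi /H.
  under eq_bigr => i _ do rewrite -(extE k t).
  rewrite (big_ord_widen l (fun i => ext k t i *: b`_i)) // big_mkcond /=.
  apply: eq_bigr => i _; case: ifPn => // ge_i.
  by rewrite /ext insubN // scale0r.
have combiV k (t : 'I_k -> K) : (k <= m)%N -> combi (@H k) t \in V.
  move=> le_km; rewrite (combiE k m) // rpred_sum // => i _; apply: rpredZ.
  by rewrite -(span_basis bV) memv_span // mem_nth ?size_tuple.
have lincV k : (k <= m)%N -> lincomb (@H k) `<=` [set X | X \in V].
  by move=> le_km _ [t _ <-]; apply: combiV.
have lincS k : (k <= m)%N -> lincomb (@H k) `<=` skew.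
  by move=> le_km X /(lincV k le_km); apply: Vskew.
have linc0 k : (0 < k)%N -> lincomb (@H k) X0.
  case: k => // k _; exists (fun i => (i == ord0)%:R) => //.
  rewrite /combi (bigD1 ord0) //= big1 ?addr0 ?scale1r // => i /negPf ->.
  by rewrite scale0r.
have inj k : (k <= m)%N -> forall t, X0 * combi (@H k) t + combi (@H k) t * X0 = 0 ->
    forall i, t i = 0.
  move=> le_km t /(injV _ (combiV k t le_km)); rewrite (combiE k m) // => t0 i.
  have /freeP/(_ _ t0)/(_ (widen_ord le_km i)) := basis_free bV.
  by rewrite extE.
have lincE : lincomb (@H m) = [set X | X \in V].
  apply/seteqP; split=> [|X VX]; first exact: lincV.
  by exists (fun i => coord b i X) => //; rewrite /combi [RHS](coord_basis bV VX).
have nzk k : (0 < k)%N -> exists2 X, lincomb (@H k) X & X ^+ 2 != 0.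
  by move=> k_gt0; exists X0 => //; apply: linc0.
split=> [|k c]; last first.
  by rewrite -lincE subrK lez_nat; apply: chain_length; [apply: lincS|apply: nzk].
exists m, (fun i => sq_closure (lincomb (@H i.+1))); split; last by rewrite subrK.
split=> i lt_im.
  split; last by rewrite -lincE; apply: sq_closure_mono; rewrite lincE; apply: lincV.
  by apply: irreducible_sq; [apply: lincS|move=> *; apply: lincomb_line|apply: nzk].
split; last first.
  apply: (sq_closure_strict (X0 := X0)) => //; [| |exact: nzk|exact: linc0|exact: inj].
    exact: lincS.
  by apply: lincS; apply: ltnW.
apply: sq_closure_mono => _ [t _ <-]; rewrite (combiE i.+1 i.+2) //.
by exists (fun j => ext i.+1 t j).
Qed.

End SquareDimension.

(** * Skew-symmetric matrices of small rank *)

Section SmallRank.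
Variable K : numClosedFieldType.

Lemma mxrank_sum_le n m I (r : seq I) (P : pred I) (A : I -> 'M[K]_(n, m)) (b : I -> nat) :
  (forall i, P i -> \rank (A i) <= b i)%N ->
  (\rank (\sum_(i <- r | P i) A i)%R <= \sum_(i <- r | P i) b i)%N.
Proof.
move=> Ab; apply: (big_ind2 (fun (A : 'M[K]_(n, m)) k => \rank A <= k)%N) => //.
  by rewrite mxrank0.
by move=> B c C d Bc Cd; apply: leq_trans (mxrank_add _ _) (leq_add Bc Cd).
Qed.

Lemma rank_diag_mx n (d : 'rV[K]_n) : \rank (diag_mx d) = #|[pred i | d 0 i != 0]|.
Proof.
pose supp (e : 'rV[K]_n) := [pred i | e 0 i != 0].
have rank_le (e : 'rV[K]_n) : (\rank (diag_mx e) <= #|supp e|)%N.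
  have -> : diag_mx e = \sum_(i | e 0 i != 0) e 0 i *: delta_mx i i.
    rewrite diag_mx_sum_delta (bigID (fun i => e 0 i != 0)) /=.
    by rewrite [X in _ + X]big1 ?addr0 // => i /negPn/eqP ->; rewrite scale0r.
  rewrite -sum1_card; apply: mxrank_sum_le => i nz.
  by rewrite mxrank_scale_nz // mxrank_delta.
pose e := \row_i ((d 0 i == 0)%:R : K).
have: diag_mx d + diag_mx e \in unitmx.
  rewrite -raddfD unitmxE det_diag unitfE; apply/prodf_neq0 => i _; rewrite !mxE.
  by have [->|nz] := eqVneq (d 0 i) 0; rewrite ?add0r ?oner_eq0 ?addr0.
rewrite -row_free_unit => /eqP rk; have := mxrank_add (diag_mx d) (diag_mx e).
rewrite rk => le_n; apply/eqP; rewrite eqn_leq rank_le /=.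
rewrite -(leq_add2r #|supp e|).
apply: leq_trans (leq_trans le_n (leq_add (leqnn _) (rank_le e))).
have -> : #|supp e| = #|predC (supp d)|.
  by apply: eq_card => i; rewrite !inE mxE; case: (d 0 i == 0); rewrite ?oner_eq0 ?eqxx.
by rewrite cardC card_ord.
Qed.

Lemma char_poly_similar n (P A : 'M[K]_n) : P \in unitmx ->
  char_poly (invmx P *m A *m P) = char_poly A.
Proof.
move=> uP; rewrite /char_poly.
have -> : char_poly_mx (invmx P *m A *m P) =
    map_mx polyC (invmx P) *m char_poly_mx A *m map_mx polyC P.
  rewrite /char_poly_mx mulmxBr mulmxBl mul_mx_scalar -scalemxAl -!map_mxM.
  by rewrite mulVmx // map_mx1 scalemx1.
rewrite !det_mulmx mulrAC -det_mulmx -map_mxM mulVmx // map_mx1 det1 mul1r //.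
Qed.

(** For a diagonal matrix both multiplicities count the diagonal entries equal to a. *)
Lemma mup_char_poly n (A : 'M[K]_n) a : diagonalizable A ->
  mup a (char_poly A) = \rank (eigenspace A a).
Proof.
case=> P uP /(similar_diagLR uP)[d]; rewrite conjVmx // => AE.
rewrite AE char_poly_similar // char_poly_trig ?diag_mx_is_trig //.
rewrite -(big_map (fun i => diag_mx d i i) xpredT (fun b => 'X - b%:P)) mu_prod_XsubC.
rewrite /eigenspace mxrank_ker.
have -> : invmx P *m diag_mx d *m P - a%:M = invmx P *m diag_mx (d - const_mx a) *m P.
  rewrite raddfB /= diag_const_mx mulmxBr mulmxBl; congr (_ - _).
  by rewrite mul_mx_scalar -scalemxAl mulVmx // scalemx1.
rewrite mxrankMfree ?row_free_unit // (eqmxMfull _ (_ : row_full (invmx P))).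
  rewrite rank_diag_mx count_map -sum1_count sum1_card.
  have := cardC [pred i | (d - const_mx a) 0 i != 0]; rewrite card_ord.
  move=> /(canRL (addKn _)) <-.
  apply: eq_card => i; rewrite !inE !mxE negbK subr_eq0.
  by rewrite -[LHS]/(diag_mx d i i == a) mxE eqxx mulr1n.
by rewrite row_full_unit unitmx_inv.
Qed.

Lemma rank1_factor n m (A : 'M[K]_(n, m)) : (\rank A <= 1)%N ->
  exists (u : 'cV[K]_n) (v : 'rV[K]_m), A = u *m v.
Proof.
rewrite leq_eqVlt ltnS leqn0 mxrank_eq0 => /orP[/eqP rkA|/eqP ->]; last first.
  by exists 0, 0; rewrite mul0mx.
by move: (col_base A) (row_base A) (mulmx_base A); rewrite rkA => u v <-; exists u, v.
Qed.

Lemma rank2_factor n m (A : 'M[K]_(n, m)) : \rank A = 2%N ->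
  exists (B : 'M[K]_(n, 2)) (C : 'M[K]_(2, m)),
    [/\ A = B *m C, row_full B & row_free C].
Proof.
move=> rkA; have := col_base_full A; have := row_base_free A.
move: (col_base A) (row_base A) (mulmx_base A); rewrite rkA => B C <- fC fB.
by exists B, C.
Qed.

Lemma skew_entry n (A : 'M[K]_n) i j : skew A -> A j i = - A i j.
Proof. by move=> /matrixP/(_ i j); rewrite !mxE. Qed.

Lemma skew_diag n (A : 'M[K]_n) i : skew A -> A i i = 0.
Proof.
move=> skA; apply/eqP; have /eqP := skew_entry i i skA.
by rewrite -subr_eq0 opprK -mulr2n mulrn_eq0.
Qed.

(** For A = u v the products A i j * A j i and A i i * A j j agree; the first one is
    - (A i j) ^+ 2 and the second one is 0. *)
Lemma skew_rank_le1 n (A : 'M[K]_n) : skew A -> (\rank A <= 1)%N -> A = 0.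
Proof.
move=> skA /rank1_factor[u [v AE]].
have AijE i j : A i j = u i 0 * v 0 j by rewrite AE mxE big_ord1.
apply/matrixP => i j; rewrite [RHS]mxE; apply/eqP; rewrite -sqrf_eq0 expr2.
rewrite -oppr_eq0 -mulrN -(skew_entry i j skA) !AijE.
by rewrite mulrACA [v 0 j * _]mulrC mulrACA -!AijE !(skew_diag _ skA) mul0r.
Qed.

(** The rotation by a quarter turn, which spans so(2). *)
Definition skew2 : 'M[K]_2 := \matrix_(i, j) ((i < j)%N%:R - (j < i)%N%:R).

Lemma mx2P (A B : 'M[K]_2) : A 0 0 = B 0 0 -> A 0 1 = B 0 1 -> A 1 0 = B 1 0 ->
  A 1 1 = B 1 1 -> A = B.
Proof.
have ord2P (i : 'I_2) : i = 0 \/ i = 1.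
  by case: i => [[|[|//]]] lt_i; [left|right]; apply: val_inj.
by move=> *; apply/matrixP => i j; case: (ord2P i) => ->; case: (ord2P j) => ->.
Qed.

Lemma skew_2x2 (A : 'M[K]_2) : skew A -> A = A 0 1 *: skew2.
Proof.
move=> skA; apply: mx2P; rewrite ?(skew_diag _ skA) !mxE /= ?subrr ?mulr0 ?subr0 ?mulr1 //.
by rewrite (skew_entry 0 1 skA) sub0r mulrN1.
Qed.

Lemma skew2_skew : skew skew2.
Proof. by apply/matrixP => i j; rewrite !mxE opprB. Qed.

Lemma skew2_conj (G : 'M[K]_2) : symm G -> skew2 *m G *m skew2 = - \adj G.
Proof.
move=> /matrixP/(_ 0 1); rewrite !mxE => G10.
have s01 : skew2 0 1 = 1 by rewrite mxE subr0.
have s10 : skew2 1 0 = -1 by rewrite mxE sub0r.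
have s00 k : skew2 k k = 0 by rewrite mxE subrr.
have adjE i j : (\adj G) i j = (-1) ^+ (j + i) * G (lift j 0) (lift i 0).
  by rewrite mxE /cofactor [row' _ _]mx11_scalar det_scalar1 !mxE.
have l0 : lift 0 0 = 1 :> 'I_2 by apply: val_inj.
have l1 : lift 1 0 = 0 :> 'I_2 by apply: val_inj.
have sumE (F : 'I_2 -> K) : \sum_i F i = F 0 + F 1.
  by rewrite big_ord_recl big_ord1; congr (_ + F _); apply: val_inj.
by apply: mx2P; rewrite [LHS]mxE sumE ![(skew2 *m G) _ _]mxE !sumE [RHS]mxE adjE
  ?l0 ?l1 ?s00 ?s01 ?s10 ?G10 /=; ring.
Qed.

Lemma skew_conj n m (A : 'M[K]_m) (B : 'M[K]_(n, m)) : skew A -> skew (B *m A *m B^T).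
Proof. by move=> skA; rewrite /skew /= !trmx_mul trmxK skA mulmxA mulmxN mulNmx. Qed.

(** With P = C D, such a matrix is C (D A D^T) C^T, whose middle factor lies in the
    line so(2). *)
Lemma skew_rank2_line n (P A B : 'M[K]_n) : \rank P = 2%N -> skew A -> skew B ->
    P *m A *m P^T = A -> P *m B *m P^T = B -> B != 0 ->
  exists a, A = a *: B.
Proof.
move=> /rank2_factor[C [D [-> _ _]]] skA skB.
have E X : skew X -> C *m D *m X *m (C *m D)^T =
    (D *m X *m D^T) 0 1 *: (C *m skew2 *m C^T).
  move=> skX; have -> : C *m D *m X *m (C *m D)^T = C *m (D *m X *m D^T) *m C^T.
    by rewrite trmx_mul !mulmxA.
  by rewrite [X in C *m X](skew_2x2 (skew_conj D skX)) -scalemxAr -scalemxAl.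
rewrite !E // => <- <-; rewrite scaler_eq0 negb_or => /andP[nz _].
by exists ((D *m A *m D^T) 0 1 / (D *m B *m D^T) 0 1); rewrite scalerA mulfVK.
Qed.

(** Writing P = C R with R C = 1, symmetry gives C = R^T G with G = C^T C, and
    squaring C J C^T for the generator J of so(2) brings in J G J = - adj G. *)
Lemma rank2_projection_sqrt n (P : 'M[K]_n) : \rank P = 2%N -> symm P -> P *m P = P ->
  exists A, [/\ skew A, P *m A = A, A *m P = A & A *m A = P].
Proof.
move=> rkP symP PP; have [C [R [PE fC fR]]] := rank2_factor rkP.
have RC : R *m C = 1%:M.
  apply: (row_full_inj fC); apply: (row_free_inj fR).
  by rewrite mulmx1 -PE -[RHS]PP PE !mulmxA.
have PC : P *m C = C by rewrite PE -mulmxA RC mulmx1.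
pose G := C^T *m C; have symG : symm G by rewrite /symm /= trmx_mul trmxK.
have CE : C = R^T *m G by rewrite mulmxA -trmx_mul -PE symP PC.
have CP : C^T *m P = C^T by rewrite -[P]symP -trmx_mul PC.
have nz_det : - \det G != 0.
  rewrite oppr_eq0 -unitfE -unitmxE -row_full_unit -col_leq_rank.
  by move: fC; rewrite -col_leq_rank {1}CE => h; apply: leq_trans h (mxrankM_maxr _ _).
pose A := C *m skew2 *m C^T; have skA : skew A by apply/skew_conj/skew2_skew.
have AA : A *m A = (- \det G) *: P.
  have -> : A *m A = C *m (skew2 *m G *m skew2) *m C^T by rewrite /A /G !mulmxA.
  rewrite skew2_conj // mulmxN mulNmx {1}CE -[R^T *m G *m _]mulmxA mul_mx_adj.
  by rewrite mul_mx_scalar -scalemxAl -trmx_mul -PE symP scaleNr.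
pose s := sqrtC (- \det G); have sE : s ^+ 2 = - \det G by apply: sqrtCK.
have nzs : s != 0 by rewrite -sqrf_eq0 sE.
exists (s^-1 *: A); split.
- exact: (@skew_scale K n).
- by rewrite -scalemxAr /A !mulmxA PC.
- by rewrite -scalemxAl /A -!mulmxA CP.
by rewrite -scalemxAl -scalemxAr AA -sE scalerA -invfM -expr2 scalerA mulVf ?scale1r // sqrf_eq0.
Qed.

End SmallRank.

(** * Spectral projections and power sums *)

Section Spectral.
Variables (K : numClosedFieldType) (n' : nat).
Local Notation n := n'.+1.
Implicit Types (S X : 'M[K]_n) (p q : {poly K}) (ls : seq K).

Lemma vanish_dvdp ls p : uniq ls -> (forall a, a \in ls -> p.[a] = 0) ->
  exists q, p = q * \prod_(a <- ls) ('X - a%:P).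
Proof.
move=> uls p0; apply/dvdpP/uniq_roots_dvdp; last by rewrite uniq_rootsE.
by apply/allP => a /p0/eqP.
Qed.

(** Identities between polynomials in S need to be checked on the eigenvalues only. *)
Lemma horner_mx_vanish S ls p : uniq ls ->
    horner_mx S (\prod_(a <- ls) ('X - a%:P)) = 0 ->
    (forall a, a \in ls -> p.[a] = 0) ->
  horner_mx S p = 0.
Proof. by move=> uls S0 /(vanish_dvdp uls)[q ->]; rewrite rmorphM /= S0 mulr0. Qed.

Definition interpol ls a : {poly K} :=
  \prod_(b <- ls | b != a) ((a - b)^-1 *: ('X - b%:P)).

Lemma interpolE ls a b : uniq ls -> b \in ls -> (interpol ls a).[b] = (b == a)%:R.
Proof.
move=> uls ls_b; rewrite horner_prod; have [->|ne_ba] := eqVneq b a.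
  by apply: big1 => c ne; rewrite !hornerE mulVf // subr_eq0 eq_sym.
by rewrite (big_rem b) //= ne_ba !hornerE subrr !(mulr0, mul0r).
Qed.

(** For S killed by the polynomial with simple roots ls, the projection onto the
    eigenspace of a along the other ones; being a polynomial in S, it is symmetric
    with S and commutes with everything that commutes with S. *)
Definition eigenproj S ls a := horner_mx S (interpol ls a).

Lemma trmx_horner S p : (horner_mx S p)^T = horner_mx S^T p.
Proof.
elim/poly_ind: p => [|p c IHp]; first by rewrite !rmorph0 trmx0.
rewrite !rmorphD !rmorphM /= !horner_mx_X !horner_mx_C linearD /= tr_scalar_mx.
rewrite -!mulmxE trmx_mul IHp; congr (_ + _).
exact: (comm_mx_horner p (comm_mx_refl _)).
Qed.

Section Projections.
Variables (S : 'M[K]_n) (ls : seq K).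
Hypothesis uls : uniq ls.
Hypothesis S0 : horner_mx S (\prod_(a <- ls) ('X - a%:P)) = 0.
Local Notation P := (eigenproj S ls).

Lemma eq_horner_mx p q : (forall a, a \in ls -> p.[a] = q.[a]) ->
  horner_mx S p = horner_mx S q.
Proof.
move=> eq_pq; apply/eqP; rewrite -subr_eq0 -rmorphB; apply/eqP.
by apply: (horner_mx_vanish uls S0) => a /eq_pq; rewrite !hornerE => ->; rewrite subrr.
Qed.

Lemma eigenproj_eigen a : a \in ls -> S *m P a = a *: P a.
Proof.
move=> ls_a; rewrite -[S in S *m _]horner_mx_X mulmxE -rmorphM -linearZ /=.
apply: eq_horner_mx => b ls_b; rewrite !hornerE interpolE //.
by case: eqP => [->|]; rewrite ?mulr0.
Qed.

Lemma eigenprojM a b : a \in ls -> b \in ls -> P a *m P b = (a == b)%:R *: P a.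
Proof.
move=> ls_a ls_b; rewrite mulmxE -rmorphM -linearZ /=.
apply: eq_horner_mx => c ls_c; rewrite !hornerE !interpolE //.
case: (eqVneq a b) => [->|ne]; first by rewrite mul1r -natrM mulnb andbb.
by case: (eqVneq c a) => [->|]; rewrite ?mul0r ?(negPf ne) ?mulr0.
Qed.

Lemma sum_eigenproj : \sum_(a <- ls) P a = 1%:M.
Proof.
rewrite -rmorph_sum -[1%:M](rmorph1 (horner_mx S)); apply: eq_horner_mx => b ls_b.
rewrite horner_sum hornerC (big_rem b) //= interpolE // eqxx big_seq big1 ?addr0 // => a.
by rewrite mem_rem_uniq // !inE interpolE // eq_sym => /andP[/negPf ->].
Qed.

Lemma eigenproj_comm a (A : 'M[K]_n) : A *m S = S *m A -> A *m P a = P a *m A.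
Proof. exact: comm_mx_horner. Qed.

Lemma eigenproj_sym a : symm S -> symm (P a).
Proof. by move=> symS; rewrite /symm /= /eigenproj trmx_horner symS. Qed.

Lemma eigenproj_id m a (v : 'M[K]_(m, n)) : a \in ls -> v *m S = a *: v -> v *m P a = v.
Proof.
move=> ls_a vS; have vq q : v *m horner_mx S q = q.[a] *: v.
  elim/poly_ind: q => [|q c IHq]; first by rewrite rmorph0 mulmx0 horner0 scale0r.
  rewrite rmorphD rmorphM /= horner_mx_X horner_mx_C !hornerE -mulmxE mulmxDr mulmxA IHq.
  by rewrite -scalemxAl vS scalerA mul_mx_scalar -scalerDl.
by rewrite vq interpolE // eqxx scale1r.
Qed.

Lemma rank_eigenproj a : a \in ls -> \rank (P a) = \rank (eigenspace S a).
Proof.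
move=> ls_a; apply/eqP; rewrite eqn_leq; apply/andP; split; apply: mxrankS.
  by apply/eigenspaceP; rewrite -(eigenproj_comm a (erefl (S *m S))) eigenproj_eigen.
rewrite -{1}(@eigenproj_id _ a (eigenspace S a)) // ?submxMl //.
exact/eigenspaceP.
Qed.

End Projections.

Lemma nilpotent_trace (A : 'M[K]_n) k : A ^+ k = 0 -> \tr A = 0.
Proof.
move=> Ak; have [rs rsE] := closed_field_poly_normal (char_poly A).
rewrite (monicP (char_poly_monic A)) scale1r in rsE.
have sz_rs : size rs = n.
  by have := size_char_poly A; rewrite rsE size_prod_XsubC => -[].
have rs0 : rs = nseq n 0.
  rewrite -sz_rs; apply/all_pred1P/allP => a rs_a /=.
  have : eigenvalue A a by rewrite eigenvalue_root_char rsE root_prod_XsubC.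
  case/eigenvalueP => v vA nzv.
  have vAk j : v *m A ^+ j = a ^+ j *: v.
    elim: j => [|j IHj]; first by rewrite !expr0 mulmx1 scale1r.
    by rewrite exprSr -mulmxE mulmxA IHj -scalemxAl vA scalerA -exprSr.
  have /eqP := vAk k; rewrite Ak mulmx0 eq_sym scaler_eq0 (negPf nzv) orbF.
  by rewrite expf_eq0 => /andP[].
have := char_poly_trace A (ltn0Sn _); rewrite rsE rs0 big_nseq subr0 -Monoid.iteropE.
rewrite -/(GRing.exp _ _) coefXn /= ltn_eqF // => /eqP.
by rewrite eq_sym oppr_eq0 => /eqP.
Qed.

(** The Hankel determinant of the power sums of the eigenvalues of S. It replaces the
    discriminant as a test for r distinct nonzero eigenvalues that is polynomial in
    the entries of S. *)
Definition hankel r S := \det (\matrix_(i < r, j < r) \tr (S ^+ (i + j).+1)).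

Lemma prod_XsubC_dvd_exp rs p : (forall a, a \in rs -> root p a) ->
  \prod_(a <- rs) ('X - a%:P) %| p ^+ size rs.
Proof.
elim: rs => [|a rs IHrs] rt; first by rewrite big_nil expr0 dvdpp.
rewrite big_cons exprS dvdp_mul ?dvdp_XsubCl ?rt ?mem_head //.
by apply: IHrs => b rs_b; apply: rt; rewrite inE rs_b orbT.
Qed.

(** If S had fewer than r nonzero eigenvalues, then S q(S) would be nilpotent for
    the polynomial q with these roots, and taking traces the coefficients of q
    would give a linear relation between the rows of the matrix of power sums. *)
Lemma hankel_eigenvalues r S : hankel r S != 0 ->
  exists ls, [/\ uniq ls, (r <= size ls)%N & forall a, a \in ls -> a != 0 /\ eigenvalue S a].
Proof.
move=> nzH; have [rs rsE] := closed_field_poly_normal (char_poly S).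
rewrite (monicP (char_poly_monic S)) scale1r in rsE.
pose ls := undup [seq a <- rs | a != 0].
have lsE a : (a \in ls) = (a != 0) && (a \in rs) by rewrite mem_undup mem_filter.
exists ls; split; first exact: undup_uniq; last first.
  by move=> a; rewrite lsE => /andP[nza rs_a]; rewrite eigenvalue_root_char rsE root_prod_XsubC.
rewrite leqNgt; apply/negP => lt_r; case/negP: nzH.
pose q : {poly K} := \prod_(a <- ls) ('X - a%:P).
have sz_q : size q = (size ls).+1 by rewrite size_prod_XsubC.
have nil j : \tr (S ^+ j.+1 * horner_mx S q) = 0.
  apply: (@nilpotent_trace _ (size rs)).
  rewrite -{1}(horner_mx_X S) -rmorphXn -rmorphM -rmorphXn /=.
  apply/eqP; rewrite -dvd_mxminpoly; apply: dvdp_trans (mxminpoly_dvd_char _) _.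
  rewrite exprSr -mulrA exprMn rsE; apply/dvdp_mull/prod_XsubC_dvd_exp => a rs_a.
  rewrite rootM rootX; have [//|nza] := eqVneq a 0.
  by rewrite root_prod_XsubC lsE nza rs_a.
apply/det0P; exists (\row_i q`_i).
  apply/eqP => /rowP/(_ (Ordinal lt_r)); rewrite !mxE /=.
  have := monic_prod_XsubC ls xpredT id; rewrite monicE -/q lead_coefE sz_q /= => /eqP ->.
  by apply/eqP; rewrite oner_eq0.
apply/rowP => j; rewrite !mxE -[RHS](nil j).
have qE : q = \sum_(i < r) q`_i *: 'X^i.
  rewrite -poly_def; apply/polyP => i; rewrite coef_poly; case: ltnP => // le_ri.
  by rewrite nth_default // sz_q; apply: leq_trans le_ri.
rewrite [in RHS]qE rmorph_sum mulr_sumr raddf_sum /=; apply: eq_bigr => i _.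
rewrite !mxE linearZ /= rmorphXn /= horner_mx_X -scalerAr linearZ /= -exprD.
by rewrite addSn addnC.
Qed.

End Spectral.

(** * Squares of skew-symmetric matrices with simple spectrum *)

Section GenericSkew.
Variables (K : numClosedFieldType) (n' : nat).
Local Notation n := n'.+1.
Implicit Types (S X H : 'M[K]_n) (p q : {poly K}) (ls : seq K).

(** X and its transpose - X have the same spectrum, so with m also - m is an
    eigenvalue of X. *)
Lemma rank_eigenspace_sq X a : skew X -> a != 0 -> eigenvalue (X ^+ 2) a ->
  (2 <= \rank (eigenspace (X ^+ 2) a))%N.
Proof.
move=> skX nza eig; pose m := sqrtC a; have mE : m ^+ 2 = a by apply: sqrtCK.
have nzm : m != 0 by rewrite -sqrf_eq0 mE.
have rkN : \rank (X + m%:M)%R = \rank (X - m%:M).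
  rewrite -[LHS]mxrank_tr raddfD /= skX tr_scalar_mx -[RHS]mxrank_opp.
  by rewrite opprB addrC.
have XmE : X ^+ 2 - a%:M = (X - m%:M) *m (X + m%:M).
  rewrite mulmxDr !mulmxBl -mE scalar_mxC addrA subrK -scalar_mxM expr2 mulmxE.
  by rewrite expr2.
have sing : (\rank (X - m%:M)%R < n)%N.
  rewrite ltn_neqAle rank_leq_row andbT; apply: contraL eig => /eqP fullX.
  rewrite /eigenvalue /eigenspace kermx_eq0 XmE /row_free mxrankMfree.
    by rewrite negbK; apply/eqP.
  by rewrite /row_free rkN; apply/eqP.
have rk1 b : \rank (X - b%:M) = \rank (X - m%:M) -> (0 < \rank (eigenspace X b))%N.
  by move=> E; rewrite /eigenspace mxrank_ker subn_gt0 E.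
have sub b : b ^+ 2 = a -> (eigenspace X b <= eigenspace (X ^+ 2) a)%MS.
  move=> bE; apply/eigenspaceP; rewrite expr2 -mulmxE mulmxA.
  have /eigenspaceP -> := submx_refl (eigenspace X b).
  by rewrite -scalemxAl; have /eigenspaceP -> := submx_refl (eigenspace X b); rewrite scalerA -expr2 bE.
have cap0 : (eigenspace X m :&: eigenspace X (- m) = 0)%MS.
  apply/eqP/rowV0P => v; rewrite sub_capmx => /andP[/eigenspaceP v1 /eigenspaceP].
  rewrite v1 => /eqP; rewrite -subr_eq0 -scalerBl opprK scaler_eq0 -mulr2n mulrn_eq0 /=.
  by rewrite (negPf nzm) => /eqP.
apply: leq_trans (mxrankS (_ : eigenspace X m + eigenspace X (- m) <= _)%MS).
  rewrite mxrank_disjoint_sum // -[2%N]/(1 + 1)%N leq_add ?rk1 //.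
  by rewrite raddfN opprK.
by rewrite addsmx_sub !sub ?sqrrN.
Qed.

Lemma eigenspace_sq_sub X a : a != 0 -> (eigenspace (X ^+ 2) a <= X)%MS.
Proof.
move=> nza; have /eigenspaceP/(congr1 (fun A => a^-1 *: A)) := submx_refl (eigenspace (X ^+ 2) a).
rewrite scalerA mulVf // scale1r => <-.
by rewrite scalemx_sub // expr2 -mulmxE mulmxA submxMl.
Qed.

(** The shape of X over its spectrum: the squares ls of the nonzero eigenvalues,
    which are the numbers +/- sqrt a, all simple. *)
Definition split_spectrum X ls :=
  [/\ uniq (0 :: ls), {in ls, forall a, \rank (eigenspace (X ^+ 2) a) = 2%N},
      \rank X = (2 * size ls)%N &
      X *m horner_mx (X ^+ 2) (\prod_(a <- ls) ('X - a%:P)) = 0].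

(** The Hankel determinant provides at least r nonzero eigenvalues of X ^+ 2; their
    eigenspaces have dimension at least 2 and lie in the row space of X, so the
    bound on the rank turns all these inequalities into equalities. *)
Lemma generic_split r X : skew X -> (\rank X <= 2 * r)%N -> hankel r (X ^+ 2) != 0 ->
  exists2 ls, size ls = r & split_spectrum X ls.
Proof.
move=> skX rkX /hankel_eigenvalues[ls [uls sz_ls eig_ls]]; set S := X ^+ 2 in eig_ls *.
have nz_ls a : a \in ls -> a != 0 by case/eig_ls.
have ge2 a : a \in ls -> (2 <= \rank (eigenspace S a))%N.
  by case/eig_ls => nza eig; apply: rank_eigenspace_sq.
pose E := (\sum_(i < size ls) eigenspace S ls`_i)%MS.
have ls_i (i : 'I_(size ls)) : ls`_i \in ls by rewrite mem_nth.
have rkE : \rank E = (\sum_(i < size ls) \rank (eigenspace S ls`_i))%N.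
  apply/mxdirectP/mxdirect_sum_eigenspace => i j _ _ /eqP.
  by rewrite nth_uniq // => /eqP/val_inj.
have subE : (E <= X)%MS by apply/sumsmx_subP => i _; apply/eigenspace_sq_sub/nz_ls.
have geE : (2 * size ls <= \rank E)%N.
  rewrite rkE mulnC -[X in (X * _)%N]card_ord -sum_nat_const.
  by apply: leq_sum => i _; apply: ge2.
have leE := mxrankS subE.
have sz_r : size ls = r by lia.
have rkX2 : \rank X = (2 * size ls)%N by lia.
have rkE2 : \rank E = (2 * size ls)%N by lia.
exists ls => //; split=> //.
- by rewrite /= uls andbT; apply/negP => /nz_ls; rewrite eqxx.
- move=> a ls_a; have lt_i : (index a ls < size ls)%N by rewrite index_mem.
  apply/eqP; rewrite eqn_leq ge2 // andbT.
  have : (\sum_(i < size ls) \rank (eigenspace S ls`_i) <= \sum_(i < size ls) 2)%N.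
    by rewrite -rkE rkE2 sum_nat_const card_ord mulnC.
  rewrite (bigD1 (Ordinal lt_i)) //= nth_index // [X in (_ <= X)%N](bigD1 (Ordinal lt_i)) //=.
  apply: contraTT; rewrite -!ltnNge => lt2; apply: leq_trans (_ : 3 + _ <= _)%N.
    by rewrite ltn_add2l; apply: leqnn.
  by apply: leq_add => //; apply: leq_sum => i _; apply: ge2.
have /submxP[M XE] : (X <= E)%MS.
  by rewrite -(geq_leqif (mxrank_leqif_sup subE)) rkX2 rkE2.
rewrite -/S {1}XE -mulmxA.
suff -> : E *m horner_mx S (\prod_(a <- ls) ('X - a%:P)) = 0 by rewrite mulmx0.
apply/eqP; rewrite -sub_kermx; apply/sumsmx_subP => i _; rewrite sub_kermx.
rewrite (big_rem _ (ls_i i)) rmorphM /= rmorphB /= horner_mx_X horner_mx_C mulmxA mulmxBr.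
by have /eigenspaceP -> := submx_refl (eigenspace S ls`_i); rewrite mul_mx_scalar subrr mul0mx.
Qed.

Section Split.
Variables (X : 'M[K]_n) (ls : seq K).
Hypothesis skX : skew X.
Hypothesis splitX : split_spectrum X ls.
Local Notation S := (X ^+ 2).
Local Notation P := (eigenproj S (0 :: ls)).

Lemma split_uniq : uniq (0 :: ls). Proof. by case: splitX. Qed.

Lemma split_uniq_ls : uniq ls. Proof. by have /andP[] := split_uniq. Qed.

Lemma split_nz a : a \in ls -> a != 0.
Proof. by apply: contraTneq => ->; have /andP[] := split_uniq. Qed.

Lemma split_mem a : a \in ls -> a \in 0 :: ls.
Proof. by move=> ls_a; rewrite inE ls_a orbT. Qed.

Lemma split_mul0 p : (forall a, a \in ls -> p.[a] = 0) -> X *m horner_mx S p = 0.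
Proof.
move=> /(vanish_dvdp split_uniq_ls)[q ->]; have [_ _ _ X0] := splitX.
rewrite mulrC rmorphM /= -mulmxE mulmxA X0 mul0mx //.
Qed.

Lemma split_prod0 : horner_mx S (\prod_(a <- 0 :: ls) ('X - a%:P)) = 0.
Proof.
rewrite big_cons subr0 rmorphM /= horner_mx_X expr2 -!mulmxE -mulmxA split_mul0 ?mulmx0 //.
by move=> a ls_a; apply/rootP; rewrite root_prod_XsubC.
Qed.

Local Notation u0 := split_uniq.
Local Notation S0 := split_prod0.

Lemma split_commX : X *m S = S *m X.
Proof. by rewrite expr2 -!mulmxE mulmxA. Qed.

Lemma split_X_proj0 : X *m P 0 = 0.
Proof.
apply: split_mul0 => a ls_a; rewrite interpolE ?u0 ?split_mem //.
by rewrite (negPf (split_nz ls_a)).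
Qed.

Lemma split_rank a : a \in ls -> \rank (P a) = 2%N.
Proof.
move=> ls_a; rewrite (rank_eigenproj u0 S0) ?split_mem //.
by have [_ rk _ _] := splitX; apply: rk.
Qed.

Lemma split_rank0 : (\rank (P 0%R) <= n - 2 * size ls)%N.
Proof.
have [_ _ <- _] := splitX; rewrite -mxrank_ker; apply: mxrankS; apply/sub_kermxP.
by rewrite -(eigenproj_comm (0 :: ls) 0 split_commX) split_X_proj0.
Qed.

Lemma split_symS : symm S. Proof. exact: sq_skew. Qed.

Lemma split_decomp (A : 'M[K]_n) : A = A *m P 0 + \sum_(a <- ls) A *m P a.
Proof. by rewrite -{1}[A]mulmx1 -(sum_eigenproj u0 S0) big_cons mulmxDr mulmx_sumr. Qed.

(** The blocks of a skew-symmetric matrix commuting with S, for the orthogonal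
    decomposition into the eigenspaces of S, are skew-symmetric themselves. *)
Lemma block_skew a A : a \in 0 :: ls -> skew A -> A *m S = S *m A -> skew (A *m P a).
Proof.
move=> ls_a skA AS; rewrite /skew /= trmx_mul skA (eigenproj_sym _ _ split_symS).
by rewrite mulmxN (eigenproj_comm _ _ AS).
Qed.

Lemma block_conj a A : a \in 0 :: ls -> A *m S = S *m A ->
  P a *m (A *m P a) *m (P a)^T = A *m P a.
Proof.
move=> ls_a AS; rewrite (eigenproj_sym _ _ split_symS) mulmxA -(eigenproj_comm _ _ AS).
by rewrite -!mulmxA !(eigenprojM u0 S0) // eqxx !scale1r // (eigenprojM u0 S0) // eqxx scale1r.
Qed.

Lemma block_mul a A : a \in 0 :: ls -> A *m S = S *m A ->
  (A *m P a) *m (A *m P a) = A *m A *m P a.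
Proof.
move=> ls_a AS; rewrite -mulmxA [P a *m _]mulmxA -(eigenproj_comm _ _ AS).
by rewrite -(mulmxA A (P a)) (eigenprojM u0 S0) // eqxx scale1r mulmxA.
Qed.

Lemma block_sq a : a \in 0 :: ls -> (X *m P a) *m (X *m P a) = a *: P a.
Proof.
move=> ls_a; rewrite (block_mul ls_a split_commX) -[X *m X]expr2.
by rewrite (eigenproj_eigen u0 S0).
Qed.

Lemma block_nz a : a \in ls -> X *m P a != 0.
Proof.
move=> ls_a; apply/eqP => XP0; have := block_sq (split_mem ls_a).
rewrite XP0 mul0mx => /esym/eqP; rewrite scaler_eq0 (negPf (split_nz ls_a)) /=.
by rewrite -mxrank_eq0 split_rank.
Qed.

(** An eigenplane carries one skew-symmetric block up to scaling, and that of X is not 0. *)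
Lemma block_line a A : a \in ls -> skew A -> A *m S = S *m A ->
  exists c, A *m P a = c *: (X *m P a).
Proof.
move=> ls_a skA AS; have ls0a := split_mem ls_a.
apply: (skew_rank2_line (split_rank ls_a)).
- exact: block_skew.
- by apply: block_skew => //; apply: split_commX.
- exact: block_conj.
- by apply: block_conj => //; apply: split_commX.
exact: block_nz.
Qed.

(** The differential of the squaring map at X is injective: its kernel commutes with S,
    hence consists of multiples of X on each plane, which X does not anticommute
    with, and vanishes on the kernel of S, which is at most a line. *)
Lemma anticommute0 H : (n <= (2 * size ls).+1)%N -> skew H -> X * H + H * X = 0 -> H = 0.
Proof.
move=> le_n skH /eqP; rewrite addr_eq0 => /eqP XH.
have HS : H *m S = S *m H.
  rewrite expr2 !mulmxE mulrA -[H * X]opprK -XH mulNr -[in LHS]mulrA -[H * X]opprK -XH.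
  by rewrite mulrN opprK mulrA.
rewrite (split_decomp H) big_seq big1 ?addr0 => [|a ls_a].
  apply: skew_rank_le1; first by apply: block_skew => //; apply: mem_head.
  by apply: leq_trans (mxrankM_maxr _ _) (leq_trans split_rank0 _); lia.
have [c HE] := block_line ls_a skH HS.
suff /eqP : (c * a *+ 2) *: P a = 0.
  rewrite scaler_eq0 -mxrank_eq0 split_rank // orbF mulrn_eq0 mulf_eq0.
  by rewrite (negPf (split_nz ls_a)) orbF /= HE => /eqP ->; rewrite scale0r.
(* H P_a = c X P_a anticommutes with X, whereas X P_a commutes with it. *)
have XHP : X *m (H *m P a) + H *m P a *m X = 0.
  rewrite -[H *m P a *m X]mulmxA -(eigenproj_comm _ _ split_commX) !mulmxA -mulmxDl.
  by rewrite [X *m H]XH addNr mul0mx.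
have XXP : X *m (X *m P a) = a *: P a.
  by rewrite mulmxA -[X *m X]expr2 (eigenproj_eigen u0 S0) ?split_mem.
rewrite -[RHS]XHP HE -scalemxAr -scalemxAl -[X *m P a *m X]mulmxA.
rewrite -(eigenproj_comm _ _ split_commX) XXP scalerA -scalerDl.
by rewrite -mulr2n.
Qed.

End Split.

End GenericSkew.

(** * A skew-symmetric matrix with simple spectrum *)

Section Example.
Variables (K : numClosedFieldType) (n' r : nat).
Local Notation n := n'.+1.
Hypothesis le_2r_n : (2 * r <= n)%N.

Let i1 (k : 'I_r) : 'I_n := inord (2 * k).
Let i2 (k : 'I_r) : 'I_n := inord (2 * k).+1.

Let i1E k : i1 k = (2 * k)%N :> nat.
Proof. by rewrite inordK //; have := ltn_ord k; lia. Qed.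

Let i2E k : i2 k = (2 * k).+1 :> nat.
Proof. by rewrite inordK //; have := ltn_ord k; lia. Qed.

Let eq11 k l : (i1 k == i1 l) = (k == l).
Proof. by rewrite -!val_eqE /= !i1E; lia. Qed.

Let eq22 k l : (i2 k == i2 l) = (k == l).
Proof. by rewrite -!val_eqE /= !i2E; lia. Qed.

Let eq12 k l : (i1 k == i2 l) = false.
Proof. by rewrite -val_eqE /= i1E i2E; lia. Qed.

Let eq21 k l : (i2 k == i1 l) = false.
Proof. by rewrite eq_sym eq12. Qed.

Let plane k : 'M[K]_n := delta_mx (i1 k) (i1 k) + delta_mx (i2 k) (i2 k).

Let rot k : 'M[K]_n := delta_mx (i1 k) (i2 k) - delta_mx (i2 k) (i1 k).

Let planeM k l : plane k *m plane l = (k == l)%:R *: plane k.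
Proof.
rewrite /plane mulmxDl !mulmxDr !mul_delta_mx_cond eq11 eq22 eq12 eq21 !mulr0n addr0 add0r.
by case: eqP => [->|]; rewrite ?scale1r ?scale0r ?addr0.
Qed.

Let rotM k l : rot k *m rot l = - ((k == l)%:R *: plane k).
Proof.
rewrite /rot /plane mulmxBl !mulmxBr !mul_delta_mx_cond eq11 eq22 eq12 eq21 !mulr0n.
by rewrite sub0r subr0; case: eqP => [->|]; rewrite ?scale1r ?scale0r ?opprD ?oppr0 ?addr0.
Qed.

Let tr_plane k : \tr (plane k) = 2.
Proof.
have tr1 (i : 'I_n) : \tr (delta_mx i i : 'M[K]_n) = 1.
  rewrite /mxtrace (bigD1 i) //= big1 ?mxE ?eqxx ?addr0 // => j /negPf ne.
  by rewrite mxE ne.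
by rewrite mxtraceD !tr1.
Qed.

Let d (k : 'I_r) : K := - (k.+1 ^ 2)%:R.

(** Rotations by a quarter turn in r coordinate planes, scaled by 1, ..., r so that the
    eigenvalues - k ^ 2 of the square are distinct. *)
Definition block_example : 'M[K]_n := \sum_(k < r) k.+1%:R *: rot k.

Lemma block_example_skew : skew block_example.
Proof.
rewrite /skew /= /block_example raddf_sum -sumrN; apply: eq_bigr => k _ /=.
by rewrite linearZ linearB /= !trmx_delta -scalerN opprB.
Qed.

Lemma rank_block_example : (\rank block_example <= 2 * r)%N.
Proof.
rewrite -[X in (_ <= 2 * X)%N]card_ord mulnC -sum_nat_const.
apply: mxrank_sum_le => k _; apply: leq_trans (mxrank_scale _ _) _.
apply: leq_trans (mxrank_add _ _) _.
by rewrite mxrank_opp !mxrank_delta.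
Qed.

Let sqE m : (block_example ^+ 2) ^+ m.+1 = \sum_k d k ^+ m.+1 *: plane k.
Proof.
have sq1 : block_example ^+ 2 = \sum_k d k *: plane k.
  rewrite expr2 /block_example mulr_suml; apply: eq_bigr => k _.
  rewrite mulr_sumr (bigD1 k) //= big1 ?addr0 => [|l ne_lk].
    rewrite -mulmxE -scalemxAl -scalemxAr rotM eqxx scale1r !scalerN scalerA -natrM.
    by rewrite mulnn -scaleNr.
  rewrite -mulmxE -scalemxAl -scalemxAr rotM eq_sym (negPf ne_lk).
  by rewrite scale0r oppr0 !scaler0.
elim: m => [|m IHm]; first by rewrite expr1 sq1; apply: eq_bigr => k _; rewrite expr1.
rewrite exprS IHm sq1 mulr_suml; apply: eq_bigr => k _.
rewrite mulr_sumr (bigD1 k) //= big1 ?addr0 => [|l ne_lk].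
  by rewrite -mulmxE -scalemxAl -scalemxAr planeM eqxx scale1r scalerA -exprS.
rewrite -mulmxE -scalemxAl -scalemxAr planeM eq_sym (negPf ne_lk).
by rewrite scale0r !scaler0.
Qed.

(** The Hankel matrix is V D V^T, with V a Vandermonde matrix and D diagonal. *)
Lemma hankel_block_example : hankel r (block_example ^+ 2) != 0.
Proof.
pose V := Vandermonde r (\row_k d k).
have -> : hankel r (block_example ^+ 2) = \det (V *m diag_mx (\row_k (2 * d k)) *m V^T).
  congr (\det _); apply/matrixP => i j; rewrite mul_mx_diag !mxE sqE raddf_sum /=.
  apply: eq_bigr => k _; rewrite linearZ /= tr_plane !mxE exprS exprD; ring.
have nzV : \det V != 0.
  rewrite det_Vandermonde; apply/prodf_neq0 => i _; apply/prodf_neq0 => j lt_ij.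
  rewrite !mxE /d opprK addrC subr_eq0 eqr_nat eqn_exp2r // eqSS.
  by rewrite neq_ltn lt_ij.
rewrite !det_mulmx det_tr det_diag !mulf_neq0 //; apply/prodf_neq0 => k _.
by rewrite mxE /d mulf_neq0 ?pnatr_eq0 // oppr_eq0 pnatr_eq0 -lt0n expn_gt0.
Qed.

End Example.

(** * The space of skew-symmetric matrices *)

Section SkewSpace.
Variables (K : numClosedFieldType) (n : nat).

Let elem (p : 'I_n * 'I_n) : 'M[K]_n := delta_mx p.1 p.2 - delta_mx p.2 p.1.

Definition skew_space : {vspace 'M[K]_n} :=
  (\sum_(p : 'I_n * 'I_n | (p.1 < p.2)%N) <[elem p]>)%VS.

Let elem_combi (c : 'I_n * 'I_n -> K) (i j : 'I_n) : (i < j)%N ->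
  (\sum_(p : 'I_n * 'I_n | (p.1 < p.2)%N) c p *: elem p) i j = c (i, j).
Proof.
move=> lt_ij; have elemE p : elem p i j = ((i, j) == p)%:R - ((j, i) == p)%:R.
  by case: p => k l; rewrite !mxE !xpair_eqE [(j == _) && _]andbC.
rewrite summxE (bigD1 (i, j)) //= big1 ?addr0 => [|p /andP[lt_p ne_p]].
  by rewrite mxE elemE eqxx xpair_eqE -!val_eqE (gtn_eqF lt_ij) subr0 mulr1.
rewrite mxE elemE eq_sym (negPf ne_p) sub0r.
case: eqP lt_p => [<- /=|]; first by rewrite ltnNge ltnW.
by rewrite mulr0n oppr0 mulr0.
Qed.

Lemma mem_skew_space X : X \in skew_space <-> skew X.
Proof.
have skV Y : Y \in skew_space -> skew Y.
  move=> /memv_sumP[u uV ->]; rewrite /skew /= raddf_sum -sumrN.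
  apply: eq_bigr => p /uV /vlineP[c ->] /=.
  by rewrite linearZ linearB /= !trmx_delta -scalerN opprB.
split=> [/skV //|skX].
pose Y := \sum_(p : 'I_n * 'I_n | (p.1 < p.2)%N) X p.1 p.2 *: elem p.
have VY : Y \in skew_space by apply: memv_sumr => p _; apply/rpredZ/memv_line.
suff -> : X = Y by [].
have lt_eq (i j : 'I_n) : (i < j)%N -> X i j = Y i j.
  by move=> lt_ij; rewrite /Y (elem_combi (fun p => X p.1 p.2)).
apply/matrixP => i j; have [/lt_eq //|lt_ji|/val_inj ->] := ltngtP i j.
  by rewrite (skew_entry j i skX) (skew_entry j i (skV _ VY)) lt_eq.
by rewrite !skew_diag //; apply: skV.
Qed.

Lemma dim_skew_space : \dim skew_space = 'C(n, 2).
Proof.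
have nz_elem (p : 'I_n * 'I_n) : (p.1 < p.2)%N -> elem p != 0.
  case: p => i j lt_ij; apply/eqP => /matrixP/(_ i j); rewrite [RHS]mxE.
  have := elem_combi (fun p => (p == (i, j))%:R) lt_ij.
  rewrite (bigD1 (i, j)) //= big1 ?addr0 => [|p /andP[_ /negPf ->]]; last by rewrite scale0r.
  by rewrite eqxx scale1r => -> /eqP; rewrite oner_eq0.
have /directvP /= -> : directv (\sum_(p : 'I_n * 'I_n | (p.1 < p.2)%N) <[elem p]>).
  apply/directv_sum_independent => u uV u0.
  have /boolp.choice[c cE] (p : 'I_n * 'I_n) : exists c, (p.1 < p.2)%N -> u p = c *: elem p.
    by case: (boolP (p.1 < p.2)%N) => [/uV/vlineP[c ->]|_]; [exists c|exists 0].
  move=> [i j] lt_ij; rewrite cE // -(elem_combi c lt_ij).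
  by rewrite -(eq_bigr _ (fun p lt_p => cE p lt_p)) u0 mxE scale0r.
rewrite (eq_bigr (fun=> 1%N)) => [|p lt_p]; last by rewrite dim_vline nz_elem.
rewrite -(pair_big_dep xpredT (fun i j : 'I_n => (i < j)%N) (fun _ _ => 1%N)) /=.
rewrite (exchange_big_dep xpredT) //= -bin2_sum big_mkord; apply: eq_bigr => j _.
by rewrite -(big_ord_widen n (fun=> 1%N) (ltnW (ltn_ord j))) sum1_card card_ord.
Qed.

End SkewSpace.

(** * Dimension and eigenvalues of generic squares *)

Section SquareVariety.
Variable K : numClosedFieldType.

Section Positive.
Variable n' : nat.
Local Notation n := n'.+1.
Implicit Types (S X : 'M[K]_n) (ls : seq K).

Lemma split_sq_neq0 X ls : split_spectrum X ls -> (0 < size ls)%N -> X ^+ 2 != 0.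
Proof.
move=> splitX lt0; have ls_a : ls`_0 \in ls by rewrite mem_nth.
apply/eqP => S0; have := eigenproj_eigen (split_uniq splitX) (split_prod0 splitX) (split_mem ls_a).
rewrite {1}S0 mul0mx => /esym/eqP; rewrite scaler_eq0 (negPf (split_nz splitX ls_a)) /=.
by rewrite -mxrank_eq0 (split_rank splitX).
Qed.

Lemma split_double X ls : skew X -> split_spectrum X ls -> double_eigenvalues (X ^+ 2).
Proof.
move=> skX splitX; have S0 := split_prod0 splitX.
have diagS : diagonalizable (X ^+ 2).
  apply/diagonalizableP; exists (0 :: ls); first exact: split_uniq splitX.
  exact: mxminpoly_min.
split=> // [|a nza]; first exact: sq_skew.
rewrite eigenvalue_root_char -root_mxminpoly => rt.
have : root (\prod_(a <- 0 :: ls) ('X - a%:P)) a.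
  by have /dvdpP[q ->] := mxminpoly_min S0; rewrite rootM rt orbT.
rewrite root_prod_XsubC inE (negPf nza) /= => ls_a.
by rewrite mup_char_poly //; have [_ rk _ _] := splitX; apply: rk.
Qed.

(** Over each nonzero eigenvalue S is a multiple of a symmetric projection of
    rank 2, which has a skew-symmetric square root supported on its image. *)
Lemma double_square S : double_eigenvalues S -> exists2 X, skew X & X ^+ 2 = S.
Proof.
case=> symS diagS dblS; have [rs urs] := (diagonalizableP S).1 diagS.
rewrite dvd_mxminpoly => /eqP S0; pose P := eigenproj S rs.
have symP a : symm (P a) by apply: eigenproj_sym.
have PM := eigenprojM urs S0.
have sqrtP a : exists A, a \in rs ->
    [/\ skew A, P a *m A = A, A *m P a = A & A *m A = a *: P a].
  case: (boolP (a \in rs)) => [rs_a|_]; last by exists 0.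
  have skew0 : skew (0 : 'M[K]_n) by rewrite /skew /= trmx0 oppr0.
  have [-> |nza] := eqVneq a 0; first by exists 0; rewrite !mulmx0 ?mul0mx scale0r.
  have [-> |nzP] := eqVneq (P a) 0; first by exists 0; rewrite !mulmx0 ?mul0mx scaler0.
  have rkP : \rank (P a) = 2%N.
    rewrite (rank_eigenproj urs S0) // -mup_char_poly // dblS //.
    by rewrite /eigenvalue -mxrank_eq0 -(rank_eigenproj urs S0) // mxrank_eq0.
  have [|A [skA PA AP AA]] := rank2_projection_sqrt rkP (symP a).
    by rewrite PM // eqxx scale1r.
  exists (sqrtC a *: A) => _; split; first exact: (@skew_scale K n).
  - by rewrite -scalemxAr PA.
  - by rewrite -scalemxAl AP.
  by rewrite -scalemxAl -scalemxAr AA scalerA -expr2 sqrtCK.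
have [A AE] := boolp.choice sqrtP.
exists (\sum_(a <- rs) A a).
  rewrite /skew /= raddf_sum -sumrN !big_seq; apply: eq_bigr => a rs_a /=.
  by have [-> _ _ _] := AE a rs_a.
have SE : S = \sum_(a <- rs) a *: P a.
  rewrite -[LHS]mulmx1 -(sum_eigenproj urs S0) mulmx_sumr !big_seq.
  by apply: eq_bigr => a rs_a; rewrite (eigenproj_eigen urs S0).
rewrite [RHS]SE expr2 mulr_suml big_seq [RHS]big_seq; apply: eq_bigr => a rs_a.
rewrite mulr_sumr (big_rem a) //= [X in _ + X]big1_seq ?addr0 => [|b].
  by rewrite -mulmxE; have [_ _ _ ->] := AE a rs_a.
rewrite mem_rem_uniq // !inE => /andP[_ /andP[ne_ba rs_b]].
have [_ _ <- _] := AE a rs_a; have [_ <- _ _] := AE b rs_b.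
rewrite -mulmxE mulmxA -(mulmxA (A a)) PM // eq_sym (negPf ne_ba).
by rewrite scale0r mulmx0 mul0mx.
Qed.

End Positive.

Lemma skew_add n c (X Y : 'M[K]_n) : skew X -> skew Y -> skew (X + c *: Y).
Proof. by move=> skX skY; rewrite /skew /= linearD linearZ /= skX skY scalerN opprD. Qed.

Lemma skew_line n t (X Y : 'M[K]_n) : skew X -> skew Y -> skew (X + t *: (Y - X)).
Proof. by move=> skX skY; apply: skew_add => //; rewrite -scaleN1r; apply: skew_add. Qed.

Lemma skew_small n (X : 'M[K]_n) : (n < 2)%N -> skew X -> X = 0.
Proof. by move=> lt_n2 skX; apply: skew_rank_le1 => //; apply: leq_trans (rank_leq_row _) _. Qed.

Lemma polyfun_hankel n' r : polyfun (fun X : 'M[K]_n'.+1 => hankel r (X ^+ 2)).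
Proof.
apply: polyfun_det => i j.
apply: eq_polyfun (polyfun_trace (polymxX (i + j).+1 (polymxX 2 (@polymx_id K _)))) => X.
by rewrite mxE.
Qed.

(** In odd size X is singular, since det X = det (- X) = - det X. *)
Lemma skew_rank_half n (X : 'M[K]_n) : skew X -> (\rank X <= 2 * n./2)%N.
Proof.
move=> skX; have := odd_double_half n; rewrite -mul2n; have := rank_leq_row X.
case: (boolP (odd n)) => [odd_n|_]; last by rewrite add0n => ? ->.
rewrite leq_eqVlt => /predU1P[fullX|]; last by lia.
have : X \in unitmx by rewrite -row_full_unit /row_full fullX.
rewrite unitmxE unitfE => /eqP[]; apply/eqP.
have /eqP : \det X = - \det X.
  by rewrite -[LHS]det_tr skX -scaleN1r detZ -signr_odd odd_n expr1 mulN1r.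
by rewrite -subr_eq0 opprK -mulr2n mulrn_eq0.
Qed.

Lemma half_generic n' : exists2 X : 'M[K]_n'.+1, skew X & hankel n'.+1./2 (X ^+ 2) != 0.
Proof.
have le_n : (2 * n'.+1./2 <= n'.+1)%N by rewrite mul2n -[leqRHS]odd_double_half leq_addl.
exists (block_example K n' n'.+1./2); first exact: block_example_skew.
exact: hankel_block_example.
Qed.

Lemma half_split n' (X : 'M[K]_n'.+1) : skew X -> hankel n'.+1./2 (X ^+ 2) != 0 ->
  exists2 ls, size ls = n'.+1./2 & split_spectrum X ls.
Proof. by move=> skX; apply: generic_split => //; apply: skew_rank_half. Qed.

(** The squaring map is an immersion at a matrix with simple spectrum, so the squares
    have the dimension of the space of skew-symmetric matrices. *)
Theorem sq_variety_dimension n :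
  has_dimension symm (sq_variety K n) ('C(n, 2)%:Z - 1).
Proof.
have -> : sq_variety K n = sq_closure [set X | X \in skew_space K n].
  rewrite /sq_closure; congr (zariski_closure _ (proj (image _ _))).
  by apply/seteqP; split=> X /mem_skew_space.
have [lt_n2|] := ltnP n 2.
  (* There are no nonzero squares, and the closure of the empty set is empty. *)
  have clos0 z : ~ sq_closure [set X | X \in skew_space K n] z.
    move=> cz; have [|X [[_ X1] _] _] := cz (zero_locus symm [set 1]); last first.
      by have /eqP := X1 1 erefl; rewrite meval1 oner_eq0.
    split; first by exists [set 1] => // _ ->; exists 0%N; apply: dhomog1.
    move=> _ [Y [[X /mem_skew_space skX <-] /eqP[]]].
    by rewrite (skew_small lt_n2 skX) expr2 mul0r.
  rewrite bin_small // sub0r; split=> [|k c [irr_c _]].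
    by exists 0%N, (fun=> set0); split; rewrite ?addNr.
  rewrite addNr lez_nat leqNgt; apply/negP => lt0k.
  by have [[_ [z cz] _] /(_ z cz)/clos0] := irr_c 0%N lt0k.
case: n => // n' lt1n; have [X skX hkX] := half_generic n'.
have [ls sz_ls splitX] := half_split skX hkX.
rewrite -(dim_skew_space K); apply: (sq_dimension (X0 := X)).
- by move=> Y /mem_skew_space.
- exact/mem_skew_space.
- by apply: split_sq_neq0 splitX _; rewrite sz_ls half_gt0.
move=> H /mem_skew_space skH; apply: (anticommute0 skX splitX) => //.
by rewrite sz_ls; have := odd_double_half n'.+1; rewrite -mul2n; case: (odd _); lia.
Qed.

(** The squares with nonzero Hankel determinant have double eigenvalues, and a
    polynomial vanishing on them vanishes on all squares. *)
Theorem sq_variety_double n :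
  sq_variety K n = zariski_closure symm (proj double_eigenvalues).
Proof.
have sS := @symm_scale K n.
have dblS : proj double_eigenvalues `<=` proj (@symm K n).
  by move=> _ [X [[symX _ _] nzX] <-]; exists X.
case: n sS dblS => [|n'] sS dblS.
  rewrite /sq_variety; congr zariski_closure.
  by apply/seteqP; split=> _ [X [h /eqP nzX] <-]; case: nzX; rewrite [X]flatmx0.
apply/seteqP; split.
  apply: closure_sub; first exact: closure_closed.
  move=> _ [_ [[X skX <-] nzS] <-]; apply/closureP => //; split; first exact: sq_skew.
  move=> p p0; apply/eqP; apply: contraT => pX.
  have [X1 skX1 hkX1] := half_generic n'.
  have pP : polyfun (fun Y : 'M[K]_n'.+1 => p.@[entries (Y ^+ 2)]).
    apply: (polyfun_comp (f := fun Y => p.@[entries Y])); first by exists p.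
    exact/polymxX/polymx_id.
  have [Y [skY pY hkY]] := polyfun_nonzero2 (@skew_line _) pP (polyfun_hankel n' _) skX skX1 pX hkX1.
  have [ls sz_ls splitY] := half_split skY hkY.
  have nzY : Y ^+ 2 != 0.
    apply: split_sq_neq0 splitY _; rewrite sz_ls half_gt0 ltnNge; apply/negP => le_n1.
    by case/eqP: nzS; rewrite (skew_small (n := n'.+1) le_n1 skX) expr2 mul0r.
  case/eqP: pY; apply: p0 => //; exists (Y ^+ 2) => //; split=> //.
  exact: split_double splitY.
apply: closure_mono => _ [S [dS nzS] <-]; have [X skX XE] := double_square dS.
by exists S => //; split=> //; exists X.
Qed.

End SquareVariety.

(** * Fibers of the squaring map *)

Section Fibers.
Variable K : numClosedFieldType.

(** A form of the determinantal equations of the rank that avoids choosing rows and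
    columns. *)
Lemma rank_le_detP n m (X : 'M[K]_n) : (\rank X <= m)%N <->
  forall (U : 'M_(m.+1, n)) (W : 'M_(n, m.+1)), \det (U *m X *m W) = 0.
Proof.
split=> [rkX U W|det0].
  apply/eqP; apply: contraT; rewrite -unitfE -unitmxE -row_full_unit -col_leq_rank => le_m.
  have := leq_trans le_m (leq_trans (mxrankM_maxl _ _) (mxrankM_maxr _ _)).
  by move=> /leq_trans/(_ rkX); rewrite ltnn.
rewrite leqNgt; apply/negP => lt_m.
have XE : pinvmx (col_base X) *m X *m pinvmx (row_base X) = 1%:M.
  rewrite -[Y in _ *m Y *m _]mulmx_base mulmxA mulVpmx ?col_base_full // mul1mx.
  by rewrite mulmxVp ?row_base_free.
have := det0 (pid_mx m.+1 *m pinvmx (col_base X)) (pinvmx (row_base X) *m pid_mx m.+1).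
rewrite (_ : _ *m X *m _ = pid_mx m.+1 *m
  (pinvmx (col_base X) *m X *m pinvmx (row_base X)) *m pid_mx m.+1); last by rewrite !mulmxA.
rewrite XE mulmx1.
rewrite mul_pid_mx minnn (minn_idPr lt_m) pid_mx_1.
by rewrite det1 => /eqP; rewrite oner_eq0.
Qed.

Lemma card_eq_image_fin (T : finType) U (F : T -> U) : injective F ->
  ([set F t | t in setT] #= `I_#|T|)%card.
Proof.
move=> injF; apply: card_eq_trans (inj_card_eq (in2W injF)) _.
apply: card_eq_trans _ (card_esym card_II).
have -> : [set: 'I_#|T|] = [set enum_rank t | t in [set: T]].
  by apply/seteqP; split=> // i _; exists (enum_val i) => //; rewrite enum_valK.
by apply/card_esym/inj_card_eq => t u _ _; apply: enum_rank_inj.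
Qed.

Section Positive.
Variable n' : nat.
Local Notation n := n'.+1.
Implicit Types (S X Y : 'M[K]_n) (ls : seq K).

Lemma hankelZ r c S : hankel r S = 0 -> hankel r (c *: S) = 0.
Proof.
move=> h0; pose D k := diag_mx (\row_(i < r) c ^+ (i + k)).
rewrite /hankel (_ : \matrix_(i, j) _ = D 1%N *m \matrix_(i, j) \tr (S ^+ (i + j).+1) *m D 0%N).
  by rewrite !det_mulmx -/(hankel r S) h0 mulr0 mul0r.
apply/matrixP => i j; rewrite mul_mx_diag mul_diag_mx !mxE exprZn linearZ /=.
by rewrite mulrAC -exprD addn1 addn0 addSn.
Qed.

(** The locus excluded by genericity: a skew-symmetric matrix of rank at most 2 r
    outside of it has 2 r simple nonzero eigenvalues. *)
Definition degenerate r : set {vspace 'M[K]_n} :=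
  proj [set X | skew_rank_le (2 * r) X /\ hankel r (X ^+ 2) = 0].

Lemma degenerate_closed r : zariski_closed skew (degenerate r).
Proof.
pose G : set {mpoly K[n * n]} := [set p |
  (exists U W, forall X : 'M[K]_n, \det ((U : 'M_((2 * r).+1, n)) *m X *m W) = p.@[entries X]) \/
  (forall X : 'M[K]_n, hankel r (X ^+ 2) = p.@[entries X])].
have GE X : (forall p, G p -> p.@[entries X] = 0) <->
    (\rank X <= 2 * r)%N /\ hankel r (X ^+ 2) = 0.
  split=> [G0|[/rank_le_detP rkX h0] p [[U [W <-]]|<- //]]; last exact: rkX.
  split; last by have [p pE] := polyfun_hankel K n' r; rewrite pE G0 //; right.
  apply/rank_le_detP => U W.
  have [p pE] : polyfun (fun X : 'M[K]_n => \det (U *m X *m W)).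
    apply: polyfun_det; apply: polymxM (polymx_cst _ _); apply: polymxM (@polymx_id K n).
    exact: polymx_cst.
  by rewrite pE G0 //; left; exists U, W.
have -> : degenerate r = proj [set X | skew X /\ forall p, G p -> p.@[entries X] = 0].
  congr proj; apply/seteqP; split=> X; first by move=> [[skX rkX] h0]; split=> //; apply/GE.
  by move=> [skX /GE[rkX h0]].
apply: cone_closed; first exact: skew_scale.
move=> c X nzc skX /GE[rkX h0]; apply/GE; rewrite mxrank_scale_nz //; split=> //.
by rewrite sqmxZ hankelZ.
Qed.

Section Fiber.
Variables (X : 'M[K]_n) (ls : seq K) (r' : nat).
Hypothesis skX : skew X.
Hypothesis splitX : split_spectrum X ls.
Hypothesis sz_ls : size ls = r'.+1.
Local Notation S := (X ^+ 2).
Local Notation P := (eigenproj S (0 :: ls)).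
Local Notation u0 := (split_uniq splitX).
Local Notation S0 := (split_prod0 splitX).

(** The skew-symmetric square roots of S that vanish on the kernel of S: on each
    eigenplane for a nonzero eigenvalue, the square root X is unique up to sign. *)
Definition signed_blocks (s : 'I_r'.+1 -> bool) : 'M[K]_n :=
  \sum_k (-1) ^+ s k *: (X *m P ls`_k).

Lemma ls_nth (k : 'I_r'.+1) : ls`_k \in ls.
Proof. by rewrite mem_nth // sz_ls. Qed.

Lemma ls0_nth (k : 'I_r'.+1) : ls`_k \in 0 :: ls.
Proof. by rewrite inE ls_nth orbT. Qed.

Lemma ls_sum (F : K -> 'M[K]_n) : \sum_(a <- ls) F a = \sum_(k < r'.+1) F ls`_k.
Proof. by rewrite (big_nth 0) big_mkord sz_ls. Qed.

Lemma signed_blocks_proj s (k : 'I_r'.+1) :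
  signed_blocks s *m P ls`_k = (-1) ^+ s k *: (X *m P ls`_k).
Proof.
rewrite /signed_blocks mulmx_suml (bigD1 k) //= big1 ?addr0 => [|l ne_lk].
  by rewrite -scalemxAl -mulmxA (eigenprojM u0 S0) ?ls0_nth // eqxx scale1r.
rewrite -scalemxAl -mulmxA (eigenprojM u0 S0) ?ls0_nth //.
rewrite nth_uniq ?sz_ls //; last exact: split_uniq_ls splitX.
by rewrite val_eqE (negPf ne_lk) scale0r mulmx0 scaler0.
Qed.

Lemma sum_blocks_sq : \sum_(k < r'.+1) ls`_k *: P ls`_k = S.
Proof.
rewrite -[RHS]mulmx1 -(sum_eigenproj u0 S0) big_cons mulmxDr.
rewrite (eigenproj_eigen u0 S0) ?mem_head // scale0r add0r mulmx_sumr ls_sum.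
by apply: eq_bigr => k _; rewrite (eigenproj_eigen u0 S0) // ls0_nth.
Qed.

Lemma signed_blocks_sq s : signed_blocks s ^+ 2 = S.
Proof.
rewrite -[RHS]sum_blocks_sq expr2 {2}/signed_blocks mulr_sumr; apply: eq_bigr => k _.
have XP := eigenproj_comm (0 :: ls) ls`_k (split_commX X).
have XPX : X *m P ls`_k *m X = X *m P ls`_k *m (X *m P ls`_k).
  rewrite {3}XP mulmxA -(mulmxA X (P _) (P _)) (eigenprojM u0 S0) ?ls0_nth //.
  by rewrite eqxx scale1r.
rewrite -(block_sq splitX) ?ls0_nth // -XPX -mulmxE -scalemxAr XP mulmxA -XP.
by rewrite signed_blocks_proj -scalemxAl scalerA -signr_addb addbb scale1r.
Qed.

Lemma signed_blocks_skew s : skew (signed_blocks s).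
Proof.
rewrite /skew /= raddf_sum -sumrN; apply: eq_bigr => k _ /=.
rewrite linearZ /= (block_skew skX (ls0_nth k)) ?scalerN //; exact: split_commX.
Qed.

Lemma rank_signed_blocks s : (\rank (signed_blocks s) <= 2 * r'.+1)%N.
Proof.
rewrite -[X in (_ <= 2 * X)%N]card_ord mulnC -sum_nat_const.
apply: mxrank_sum_le => k _; apply: leq_trans (mxrank_scale _ _) _.
by apply: leq_trans (mxrankM_maxr _ _) _; rewrite (split_rank splitX (ls_nth k)).
Qed.

(** The restriction N of a square root of S to the kernel of S is skew-symmetric with
    N ^+ 2 = 0. It vanishes if the planes already exhaust the rank; and in dimension
    less than 4, where the image of N lies in its kernel, N has rank at most 1. *)
Lemma root_kernel0 Y : skew Y -> Y ^+ 2 = S ->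
    (\rank Y <= 2 * r'.+1)%N \/ (n < 2 * r'.+1 + 4)%N ->
  Y *m P 0 = 0.
Proof.
move=> skY YE; have YS : Y *m S = S *m Y by rewrite -YE expr2 -!mulmxE mulmxA.
have SP0 : S *m P 0 = 0 by rewrite (eigenproj_eigen u0 S0) ?mem_head ?scale0r.
have [_ _ rkX _] := splitX; rewrite sz_ls in rkX.
case=> [rkY|lt_n].
  have leXS : (X <= S)%MS.
    rewrite [X in (X <= _)%MS](split_decomp splitX) (split_X_proj0 splitX) add0r ls_sum.
    apply: summx_sub => k _; apply: mulmx_sub.
    have nz : ls`_k != 0 := split_nz splitX (ls_nth k).
    rewrite -[P _](scalerK nz) -(eigenproj_eigen u0 S0) ?ls0_nth //.
    by rewrite (eigenproj_comm _ _ (erefl (S *m S))) scalemx_sub // submxMl.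
  have leSY : (S <= Y)%MS by rewrite -YE expr2 -mulmxE submxMl.
  have /submxP[M ->] : (Y <= S)%MS.
    rewrite -(geq_leqif (mxrank_leqif_sup leSY)).
    by apply: leq_trans rkY _; rewrite -rkX; apply: mxrankS.
  by rewrite -mulmxA SP0 mulmx0.
pose N := Y *m P 0; have PN : P 0 *m N = N.
  by rewrite mulmxA -(eigenproj_comm _ _ YS) -mulmxA (eigenprojM u0 S0) ?mem_head // eqxx scale1r.
have NN : N *m N = 0.
  by rewrite {1}/N -mulmxA PN mulmxA -[Y *m Y]expr2 YE SP0.
apply: skew_rank_le1; first by apply: block_skew => //; apply: mem_head.
have : (\rank N <= \rank (P 0%R :&: kermx N))%N.
  apply: mxrankS; rewrite sub_capmx; apply/andP; split; last exact/sub_kermxP.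
  exact: submxMl.
have := mxrank_mul_ker (P 0) N; rewrite PN; have := split_rank0 splitX.
rewrite sz_ls -/N; move: (\rank N) (\rank (P 0)) (\rank _) => x y z; lia.
Qed.

Lemma root_signed_blocks Y : skew Y -> Y ^+ 2 = S -> Y *m P 0 = 0 ->
  exists s, Y = signed_blocks s.
Proof.
move=> skY YE Y0; have YS : Y *m S = S *m Y by rewrite -YE expr2 -!mulmxE mulmxA.
have sgn (k : 'I_r'.+1) : exists b : bool, Y *m P ls`_k = (-1) ^+ b *: (X *m P ls`_k).
  have [c cE] := block_line skX splitX (ls_nth k) skY YS.
  suff /eqP : c ^+ 2 = 1.
    rewrite sqrf_eq1 => /orP[] /eqP c1; [exists false|exists true].
      by rewrite cE c1.
    by rewrite cE c1.
  have : (c ^+ 2 - 1) * ls`_k *: P ls`_k = 0.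
    rewrite mulrBl mul1r scalerBl -scalerA -(block_sq splitX) ?ls0_nth //.
    rewrite expr2 -scalerA scalemxAr scalemxAl -cE.
    rewrite (block_mul splitX (ls0_nth k) YS) (block_sq splitX (ls0_nth k)) -[Y *m Y]expr2 YE.
    by rewrite (eigenproj_eigen u0 S0) ?ls0_nth // subrr.
  move/eqP; rewrite scaler_eq0 -[P _ == 0]mxrank_eq0 (split_rank splitX) ?ls_nth // orbF.
  by rewrite mulf_eq0 (negPf (split_nz splitX (ls_nth k))) orbF subr_eq0 => /eqP.
have [s sE] := boolp.choice sgn; exists s.
rewrite [LHS](split_decomp splitX) Y0 add0r ls_sum.
by apply: eq_bigr => k _; rewrite sE.
Qed.

(** Changing all signs at once does not change the point of projective space; the sign
    on the first plane is normalized to be +. *)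
Definition signs (e : {ffun 'I_r' -> bool}) (k : 'I_r'.+1) : bool :=
  if unlift ord0 k is Some j then e j else false.

Definition root_point e : {vspace 'M[K]_n} := <[signed_blocks (signs e)]>%VS.

Lemma signed_blocks_neq0 s : signed_blocks s != 0.
Proof.
apply: contraNneq (split_sq_neq0 splitX _) => [s0|]; last by rewrite sz_ls.
by rewrite -(signed_blocks_sq s) s0 expr2 mul0r.
Qed.

Lemma root_point_inj : injective root_point.
Proof.
move=> e e' /(eq_vline _ (signed_blocks_neq0 _))[c _ E].
have Ek k : (-1) ^+ signs e' k = c * (-1) ^+ signs e k.
  have := congr1 (fun A => A *m P ls`_k) E; rewrite -scalemxAl !signed_blocks_proj scalerA.
  move/eqP; rewrite -subr_eq0 -scalerBl scaler_eq0 (negPf (block_nz splitX (ls_nth k))).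
  by rewrite orbF subr_eq0 => /eqP.
have c1 : c = 1 by have := Ek ord0; rewrite /signs unlift_none !expr0 mulr1.
apply/ffunP => j; have := Ek (lift ord0 j); rewrite /signs liftK c1 mul1r.
by move/signr_inj.
Qed.

Lemma signed_blocks_point s : exists e, <[signed_blocks s]>%VS = root_point e.
Proof.
exists [ffun j => s (lift ord0 j) (+) s ord0]; rewrite /root_point.
suff -> : signed_blocks s = (-1) ^+ s ord0 *: signed_blocks (signs [ffun j => s (lift ord0 j) (+) s ord0]).
  by rewrite vlineZ // signr_eq0.
rewrite /signed_blocks scaler_sumr; apply: eq_bigr => k _; rewrite scalerA -signr_addb.
congr (_ ^+ _ *: _); rewrite /signs; case: unliftP => [j|] ->; last by rewrite addbF.
by rewrite ffunE addbC -addbA addbb addbF.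
Qed.

Lemma root_point_fiber e : sq_fiber X (root_point e).
Proof.
exists (signed_blocks (signs e)) => //; split; last exact: signed_blocks_neq0.
split; [exact: signed_blocks_skew| |by rewrite signed_blocks_sq].
by rewrite signed_blocks_sq; apply: split_sq_neq0 splitX _; rewrite sz_ls.
Qed.

Lemma fiber_root_point Y : Y != 0 -> sq_fiber X <[Y]>%VS ->
    (\rank Y <= 2 * r'.+1)%N \/ (n < 2 * r'.+1 + 4)%N ->
  exists e, <[Y]>%VS = root_point e.
Proof.
move=> nzY [Y1 [[skY1 nzS eqS] nzY1] /(eq_vline _ nzY1)[k nzk ->]].
have [c nzc cE] := (eq_vline _ nzS).1 eqS; pose Y2 := sqrtC c *: Y1.
have nzs : sqrtC c != 0 by rewrite sqrtC_eq0.
rewrite mxrank_scale_nz // -(mxrank_scale_nz Y1 nzs) vlineZ // -(vlineZ Y1 nzs) -/Y2.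
have skY2 : skew Y2 by apply: (@skew_scale K n).
have YE : Y2 ^+ 2 = S by rewrite sqmxZ sqrtCK -cE.
move=> h; have [s ->] := root_signed_blocks skY2 YE (root_kernel0 skY2 YE h).
exact: signed_blocks_point.
Qed.

Lemma fiber_low_rank_card :
  (sq_fiber X `&` proj (skew_rank_le (2 * r'.+1)) #= `I_(2 ^ r'))%card.
Proof.
have <- : #|{ffun 'I_r' -> bool}| = (2 ^ r')%N by rewrite card_ffun card_bool card_ord.
rewrite (_ : _ `&` _ = [set root_point e | e in setT]).
  exact: card_eq_image_fin root_point_inj.
apply/seteqP; split=> [z [fz [Y [[skY rkY] nzY] zE]]|_ [e _ <-]].
  by rewrite -zE in fz *; have [e ->] := fiber_root_point nzY fz (or_introl rkY); exists e.
split; first exact: root_point_fiber.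
exists (signed_blocks (signs e)) => //; split; last exact: signed_blocks_neq0.
by split; [apply: signed_blocks_skew|apply: rank_signed_blocks].
Qed.

Lemma fiber_card : (n < 2 * r'.+1 + 4)%N -> (sq_fiber X #= `I_(2 ^ r'))%card.
Proof.
move=> lt_n; have <- : #|{ffun 'I_r' -> bool}| = (2 ^ r')%N by rewrite card_ffun card_bool card_ord.
rewrite (_ : sq_fiber X = [set root_point e | e in setT]).
  exact: card_eq_image_fin root_point_inj.
apply/seteqP; split=> [z fz|_ [e _ <-]]; last exact: root_point_fiber.
have [Y [[skY _ _] nzY] zE] := fz; rewrite -zE in fz *.
by have [e ->] := fiber_root_point nzY fz (or_intror lt_n); exists e.
Qed.

End Fiber.

End Positive.

Theorem sq_fiber_card n r : (0 < r)%N -> (2 * r <= n)%N ->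
  exists Z : set {vspace 'M[K]_n},
    [/\ zariski_closed skew Z,
        Z `<` proj (skew_rank_le (2 * r)) &
        forall X : 'M[K]_n,
          X != 0 -> skew_rank_le (2 * r) X -> ~ Z <[X]>%VS ->
          [/\ X ^+ 2 != 0,
              (sq_fiber X `&` proj (skew_rank_le (2 * r)) #= `I_(2 ^ (r - 1)))%card &
              (n < 2 * r + 4)%N -> (sq_fiber X #= `I_(2 ^ (r - 1)))%card]].
Proof.
case: r n => // r' [//|n'] _ le_n; rewrite subn1 /=.
have mem_deg X : X != 0 -> skew_rank_le (2 * r'.+1) X ->
    hankel r'.+1 (X ^+ 2) = 0 -> degenerate r'.+1 <[X]>%VS.
  by move=> nzX rkX h0; exists X.
exists (@degenerate n' r'.+1); split; first exact: degenerate_closed.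
  split=> [_ [X [[rkX _] nzX] <-]|sub_deg]; first by exists X.
  pose X := block_example K n' r'.+1.
  have hX : hankel r'.+1 (X ^+ 2) != 0 by apply: hankel_block_example.
  have rkX : skew_rank_le (2 * r'.+1) X.
    by split; [apply: block_example_skew|apply: rank_block_example].
  have nzX : X != 0.
    have [ls sz_ls splitX] := generic_split rkX.1 rkX.2 hX.
    apply: contraNneq (split_sq_neq0 splitX _) => [->|]; last by rewrite sz_ls.
    by rewrite expr2 mul0r.
  have [|Y [[_ h0] nzY]] := sub_deg <[X]>%VS; first by exists X.
  by move=> /(eq_vline _ nzY)[c _ XE]; case/eqP: hX; rewrite XE sqmxZ hankelZ.
move=> X nzX [skX rkX] ndeg.
have hX : hankel r'.+1 (X ^+ 2) != 0 by apply/eqP => h0; apply: ndeg; apply: mem_deg.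
have [ls sz_ls splitX] := generic_split skX rkX hX.
split; first by apply: split_sq_neq0 splitX _; rewrite sz_ls.
  exact: fiber_low_rank_card skX splitX sz_ls.
exact: fiber_card skX splitX sz_ls.
Qed.

End Fibers.

Theorem theorem2p1 (R : realType) (n : nat) :
  [/\ has_dimension symm (sq_variety R[i] n) ('C(n, 2)%:Z - 1),
      sq_variety R[i] n = zariski_closure symm (proj double_eigenvalues) &
      forall r : nat, (0 < r)%N -> (2 * r <= n)%N ->
        exists Z : set {vspace 'M[R[i]]_n},
          [/\ zariski_closed skew Z,
              Z `<` proj (skew_rank_le (2 * r)) &
              forall X : 'M[R[i]]_n,
                X != 0 -> skew_rank_le (2 * r) X -> ~ Z <[X]>%VS ->
                [/\ X ^+ 2 != 0,
                    (sq_fiber X `&` proj (skew_rank_le (2 * r))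
                       #= `I_(2 ^ (r - 1)))%card &
                    (n < 2 * r + 4)%N ->
                      (sq_fiber X #= `I_(2 ^ (r - 1)))%card]]].
Proof.
split; [exact: sq_variety_dimension|exact: sq_variety_double|].
by move=> r r_gt0 le_rn; apply: sq_fiber_card.
Qed.
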